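(* Let $d\ge1$ be an integer, $h\in(0,1]$ and $L>0$. For every $C>0$, the sequence $a_n=n^{-\frac{2h}{2h+d}}$ is a lower minimax rate of convergence on the class $\mathcal{B}^{(h,C,L)}$, i.e. $$\liminf_{n\to\infty}\ \inf_{\hat F_n}\ \sup_{P\in\mathcal{B}^{(h,C,L)}}\frac{\mathbb{E}_{D_n\sim P^n}[R_P(\hat F_n)]-R_P(F^\ast)}{n^{-\frac{2h}{2h+d}}}>0.$$ More precisely, there exists a constant $C_1>0$ independent of $C$ such that, for every $C>0$, $$\liminf_{n\to\infty}\ \inf_{\hat F_n}\ \sup_{P\in\mathcal{B}^{(h,C,L)}}\frac{\mathbb{E}_{D_n\sim P^n}[R_P(\hat F_n)]-R_P(F^\ast)}{C^{\frac{2d}{2h+d}}\,n^{-\frac{2h}{2h+d}}}\ge C_1.$$ Here the infimum is over all distributional regression models $\hat F_n$ trained on $D_n$.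
   Context: Setting: $(X,Y)\in\mathbb{R}^d\times\mathbb{R}$ is a random pair with distribution $P$, $P_X$ is the marginal law of $X$, and $F^\ast_x(y)=P(Y\le y\mid X=x)$ is the conditional distribution function of $Y$ given $X=x$ (a version of it). The training sample is $D_n=\{(X_i,Y_i),1\le i\le n\}\sim P^n$ (i.i.d. with law $P$), independent of the test pair $(X,Y)\sim P$. A distributional regression model (predictor) $\hat F_n$ is a (measurable) map assigning to the training sample $D_n$ and to each $x\in\mathbb{R}^d$ a distribution function $\hat F_{n,x}$ on $\mathbb{R}$. For a distribution function $F$ and $y\in\mathbb{R}$, $\mathrm{CRPS}(F,y)=\int_{\mathbb{R}}(F(z)-\mathbf{1}_{y\le z})^2\,dz$. The risk of a predictor $\hat F:x\mapsto\hat F_x$ is $R_P(\hat F)=\mathbb{E}_{(X,Y)\sim P}[\mathrm{CRPS}(\hat F_X,Y)]$. When $Y$ is integrable, the excess risk satisfies $\mathbb{E}_{D_n\sim P^n}[R_P(\hat F_n)]-R_P(F^\ast)=\mathbb{E}_{D_n\sim P^n,X\sim P_X}\left[\int_{\mathbb{R}}|\hat F_{n,X}(z)-F^\ast_X(z)|^2\,dz\right]$. $\mathcal{B}^{(h,C,L)}$ is the class of distributions of $(X,Y)$ such that: i) $Y\in\{0,L\}$ and $X$ is uniformly distributed on $[0,1]^d$; ii) $\|F^\ast_{x'}-F^\ast_x\|_{L^2}\le C\|x'-x\|^h$ for all $x,x'\in[0,1]^d$, where $\|\cdot\|_{L^2}$ is the norm of $L^2(\mathbb{R})$ (Lebesgue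 measure) and $\|\cdot\|$ is the Euclidean norm. *)

(* Defs.v *)
From HB Require Import structures.
From mathcomp Require Import all_boot all_order all_algebra.
From mathcomp Require Import all_classical all_reals all_analysis.

Set Implicit Arguments.
Unset Strict Implicit.
Unset Printing Implicit Defensive.

Import Order.TTheory GRing.Theory Num.Theory.
Import numFieldNormedType.Exports.

Local Open Scope classical_set_scope.
Local Open Scope ring_scope.

Definition fst_mfun {d1 d2 : measure_display} {T1 : measurableType d1}
    {T2 : measurableType d2} : {mfun (T1 * T2)%type >-> T1} :=
  HB.pack (@fst T1 T2) (isMeasurableFun.Build _ _ _ _ _ measurable_fst).

Lemma measurable_cons_tuple {dT : measure_display} {T : measurableType dT}
    {n : nat} :
  measurable_fun [set: T * n.-tuple T]
    (fun p => [the n.+1.-tuple T of p.1 :: p.2]).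
Proof. exact: measurable_cons. Qed.

Definition cons_mfun {dT : measure_display} {T : measurableType dT} {n : nat} :
    {mfun (T * n.-tuple T)%type >-> n.+1.-tuple T} :=
  HB.pack (fun p : T * n.-tuple T => [the n.+1.-tuple T of p.1 :: p.2])
    (isMeasurableFun.Build _ _ _ _ _ measurable_cons_tuple).

(* The n-fold product measure of P on n-tuples, built by prepending one
   independent coordinate at a time. *)
Fixpoint power_prob {R : realType} {dT : measure_display}
    {T : measurableType dT} (P : probability T R) (n : nat) :
    probability (n.-tuple T) R :=
  match n with
  | 0 => dirac [tuple]
  | m.+1 => distribution (P \x power_prob P m)%E cons_mfun
  end.

Lemma power_prob_rect {R : realType} {dT : measure_display}
    {T : measurableType dT} (P : probability T R) (n : nat) (A : 'I_n -> set T) :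
  (forall i, measurable (A i)) ->
  power_prob P n [set t | forall i, A i (tnth t i)] = (\prod_(i < n) P (A i))%E.
Proof.
elim: n A => [|n IH] A mA.
  rewrite big_ord0 /= diracE mem_set//= => -[]//.
rewrite big_ord_recl /= -IH//.
rewrite /distribution /pushforward/= -product_measure1E//; last first.
  rewrite (_ : mkset _ = \bigcap_(i in [set: 'I_n])
     ((@tnth n T)^~ i @^-1` A (lift ord0 i))); last first.
    by apply/seteqP; split => [t /= h i _|t /= h i]; exact: h.
  apply: fin_bigcap_measurable => // i _.
  rewrite -[X in measurable X]setTI; exact: measurable_tnth.
congr (product_measure1 _ _ _); apply/seteqP; split => [[x t] /= h|[x t] /= [hx ht] i].
  split; first exact: (h ord0).
  by move=> i; have := h (lift ord0 i); rewrite tnthS.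
case: (unliftP ord0 i) => [j ->|->]; last exact: hx.
by rewrite tnthS; exact: ht.
Qed.

(* [measurableTypeR R] is R with its Borel sets, the type carrying
   [lebesgue_measure]. *)
Notation covariate R d := (d.-tuple (measurableTypeR R)).
Notation observation R d := (covariate R d * measurableTypeR R)%type.

(* A distribution function on the line: nondecreasing, right-continuous, with
   limits 0 at -oo and 1 at +oo. *)
Notation distfun R := (cumulativeBounded (0 : R) (1 : R)).

(* Normalized Lebesgue measure on [0,1]^d, as the d-fold product of the uniform
   law on [0,1]. *)
Definition uniform_cube (R : realType) (d : nat) :
    probability (covariate R d) R :=
  power_prob (uniform_prob (@ltr01 R)) d.

Definition cube (R : realType) (d : nat) : set (covariate R d) :=
  [set x | forall i, 0 <= (tnth x i : R) <= 1].

Definition euclid_dist (R : realType) (d : nat) (x y : covariate R d) : R :=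
  Num.sqrt (\sum_(i < d) ((tnth x i : R) - (tnth y i : R)) ^+ 2).

Definition CRPS (R : realType) (F : distfun R) (y : R) : \bar R :=
  (\int[lebesgue_measure]_z ((F z - (y <= z)%R%:R) ^+ 2)%:E)%E.

Definition risk (R : realType) (d : nat)
    (P : probability (observation R d) R) (F : covariate R d -> distfun R) :
    \bar R :=
  (\int[P]_p CRPS (F p.1) p.2)%E.

Definition marginal_law (R : realType) (d : nat)
    (P : probability (observation R d) R) : probability (covariate R d) R :=
  distribution P fst_mfun.

(* F is a version of the conditional distribution function of Y given X:
   P(X \in A, Y <= y) = \int_A F_x(y) P_X(dx) for all A and y. *)
Definition is_cond_cdf (R : realType) (d : nat)
    (P : probability (observation R d) R) (F : covariate R d -> distfun R) :
    Prop :=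
  (forall y : R, measurable_fun [set: covariate R d] (fun x => F x y)) /\
  (forall (A : set (covariate R d)) (y : R), measurable A ->
    P (A `*` `]-oo, y]) =
    (\int[marginal_law P]_(x in A) (F x y)%:E)%E).

Definition class_B (R : realType) (d : nat) (h C L : R) :
    set (probability (observation R d) R) :=
  [set P : probability (observation R d) R |
    [/\ P ([set: covariate R d] `*` [set (0 : R); L]) = 1%E,
      (forall A, measurable A -> marginal_law P A = uniform_cube R d A) &
      exists2 F : covariate R d -> distfun R, is_cond_cdf P F &
        forall x x', cube x -> cube x' ->
          ('N[lebesgue_measure]_2%:E [(fun z => (F x' z - F x z)%:E)]
            <= (C * euclid_dist x' x `^ h)%:E)%E]].

(* Measurability in (D_n, x) with respect to the sigma-algebra generated by the
   evaluations F |-> F z on distribution functions. *)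
Definition is_predictor (R : realType) (d n : nat)
    (Fhat : n.-tuple (observation R d) -> covariate R d -> distfun R) : Prop :=
  forall z : R,
    measurable_fun [set: n.-tuple (observation R d) * covariate R d]
      (fun p => Fhat p.1 p.2 z).

Definition excess_risk (R : realType) (d n : nat)
    (P : probability (observation R d) R)
    (Fhat : n.-tuple (observation R d) -> covariate R d -> distfun R)
    (Fstar : covariate R d -> distfun R) : \bar R :=
  (\int[power_prob P n]_D risk P (Fhat D) - risk P Fstar)%E.

(* Infimum over predictors of the supremum over the class of the excess risk
   divided by a. Versions Fstar of the conditional distribution function of P
   agree P_X-almost everywhere, so letting Fstar range over all of them does not
   affect the supremum. *)
Definition minimax_ratio (R : realType) (d : nat) (h C L a : R) (n : nat) :
    \bar R :=
  ereal_inf [set ereal_sup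
      [set r | exists P Fstar, [/\ class_B h C L P, is_cond_cdf P Fstar &
         r = (excess_risk P Fhat Fstar / a%:E)%E]]
    | Fhat in @is_predictor R d n].

(* Main.v *)
Require Import Defs.
From HB Require Import structures.
From mathcomp Require Import all_boot all_order all_algebra.
From mathcomp Require Import all_classical all_reals all_analysis.
From mathcomp Require Import ring lra measurable_realfun.

(** Assouad's method. Cut [0,1]^d into m^d cells and let Y be 0 with probability
    eta_s(X) = 1/2 +- a g(X) and L otherwise, where g is a bump in every cell and
    the sign s is chosen cell by cell; a is of order C m^-h, so that the Hoelder
    condition holds. Since Y takes only two values, the excess risk is at least
    the mean of the integral over [0, L[ of (Fhat_X(z) - eta_s(X))^2.
    Fix x in the cell k. Flipping s in k multiplies the likelihood of a sample
    point by a factor different from 1 only when the point lies in k, and the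
    Hellinger affinity of the two samples is at least 1 - n a^2 m^-d, which is
    bounded below when m^(2h+d) is of order n C^2 / L. Hence no predictor does
    well for both signs, and averaging over s gives a lower bound of order
    L a^2 ~ C^(2d/(2h+d)) n^(-2h/(2h+d)). All likelihoods are taken with respect
    to the model with eta = 1/2. *)

Set Implicit Arguments.
Unset Strict Implicit.
Unset Printing Implicit Defensive.

Import Order.TTheory GRing.Theory Num.Theory.
Import numFieldNormedType.Exports.

Local Open Scope classical_set_scope.
Local Open Scope ring_scope.

(** * Joint measurability of distribution functions *)

(** Binary labels turn the estimation of a distribution into that of a number: on [[0, L[] the
    conditional distribution function is the constant [eta x], and the Hoelder condition on it
    becomes one on [eta] with constant C / sqrt L.

    The comparison of two samples rests on one algebraic inequality, linear in the likelihoods [p],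
    [q] and in any [r >= 0] with [r ^+ 2 <= p * q]. It integrates term by term, and [r] can be
    chosen so that it factors over the observations. Its price is half of the squared separation, so
    the integral of [r] must exceed 1/2; asking n a^2 m^-d <= 1/4 makes it at least 3/4.

    The amplitude saturates the Hoelder condition, a sqrt L m^h = C. Then a <= 1 holds only for n
    large in terms of C. Thus C enters the threshold on n and the factor C^(2d/(2h+d)), while the
    remaining constant depends on d, h and L alone.

    The excess risk is a difference of extended reals in which the risk of a predictor may be
    infinite; only the risk of the true conditional law has to be finite. Everything else is an
    integral of nonnegative functions, so joint measurability is all that Tonelli requires. *)

Lemma measurable_distfun_pair (R : realType) d (T : measurableType d)
    (F : T -> distfun R) :
  (forall z, measurable_fun [set: T] (fun t => F t z)) ->
  measurable_fun [set: T * measurableTypeR R] (fun p => F p.1 p.2).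
Proof.
move=> mF; apply: (measurability _ (RGenInftyO.measurableE R)).
move=> _ [_ [x ->] <-]; rewrite setTI.
(* By right continuity and monotonicity, [F t z < x] exactly when [F t q < x] for some rational
   [q > z]. This yields joint measurability from measurability at each fixed point. *)
have -> : (fun p : T * measurableTypeR R => F p.1 p.2) @^-1` `]-oo, x[ =
    \bigcup_(q : rat) (((fun t => F t (ratr q)) @^-1` `]-oo, x[) `*`
                      `]-oo, (ratr q : R)[).
  apply/seteqP; split => [[t z]/=|[t z] /= [q _]/=]; rewrite !in_itv/=.
    move=> Fx.
    have e0 : 0 < (x - F t z) / 2 by rewrite divr_gt0// subr_gt0.
    have [e he] := nondecreasing_right_continuousP z (F t) e0.
    have [q] : exists q, ratr q \in `]z, z + e%:num[.
      by apply: rat_in_itvoo; rewrite ltrDl.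
    rewrite in_itv/= => /andP[zq qe]; exists q => //=.
    rewrite !in_itv/=; split => //.
    apply: (le_lt_trans (cumulative_is_nondecreasing (F t) _ _ (ltW qe))).
    apply: (le_lt_trans he).
    have mid (a b : R) : a < b -> a + (b - a) / 2 < b by move=> ?; lra.
    exact: mid.
  move=> [Fx zq].
  exact: (le_lt_trans (cumulative_is_nondecreasing (F t) _ _ (ltW zq))).
apply: bigcupT_measurable_rat => q; apply: measurableX => //.
by rewrite -[X in measurable X]setTI; exact: mF.
Qed.

(** * Integrals against product measures *)

Section power_prob_integral.
Context {R : realType} {dT : measure_display} {T : measurableType dT}.
Local Open Scope ereal_scope.

Lemma ge0_integral_power_probS (P : probability T R) n
    (G : n.+1.-tuple T -> \bar R) :
  measurable_fun [set: _] G -> (forall t, 0 <= G t) ->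
  \int[power_prob P n.+1]_t G t =
  \int[P]_x \int[power_prob P n]_t G [the n.+1.-tuple T of x :: t].
Proof.
move=> mG G0; rewrite [LHS]ge0_integral_distribution//.
rewrite (fubini_tonelli1 (G \o cons_mfun))//.
- by apply: measurableT_comp => //; exact: measurable_cons_tuple.
- by move=> ?; exact: G0.
Qed.

Lemma measurable_prod_tnth n (w : T -> R) : measurable_fun [set: T] w ->
  measurable_fun [set: n.-tuple T] (fun t => (\prod_(i < n) w (tnth t i))%R).
Proof.
move=> mw; apply: (@measurable_prod _ _ _ _ _ _ (fun i t => w (tnth t i))).
by move=> i _; apply: measurableT_comp => //; exact: measurable_tnth.
Qed.

(** The density is given as a change-of-integral formula, so that the induction can apply it to the
    inner integral over the remaining coordinates. The result is the product form of the likelihood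
    of an i.i.d. sample. *)
Lemma power_prob_density (P M : probability T R) (w : T -> R) :
  (forall x, 0 <= w x)%R -> measurable_fun [set: T] w ->
  (forall G : T -> \bar R, measurable_fun [set: T] G -> (forall x, 0 <= G x) ->
    \int[P]_x G x = \int[M]_x (G x * (w x)%:E)) ->
  forall n (G : n.-tuple T -> \bar R), measurable_fun [set: _] G ->
    (forall t, 0 <= G t) ->
    \int[power_prob P n]_t G t =
    \int[power_prob M n]_t (G t * (\prod_(i < n) w (tnth t i))%:E).
Proof.
move=> w0 mw PM; elim=> [|n IH] G mG G0.
  by apply: eq_integral => t _; rewrite big_ord0 mule1.
have mGc : measurable_fun [set: T * n.-tuple T]
    (fun p => G [the n.+1.-tuple T of p.1 :: p.2]).
  by apply: measurableT_comp => //; exact: measurable_cons_tuple.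
have mwn : measurable_fun [set: n.-tuple T]
    (fun t => (\prod_(i < n) w (tnth t i))%:E).
  by apply/measurable_EFinP; exact: measurable_prod_tnth.
rewrite !ge0_integral_power_probS//; last 2 first.
- apply: emeasurable_funM => //; apply/measurable_EFinP.
  exact: measurable_prod_tnth.
- by move=> t; rewrite mule_ge0// lee_fin prodr_ge0.
have mI : measurable_fun [set: T]
    (fun x => \int[power_prob P n]_t G [the n.+1.-tuple T of x :: t]).
  exact: (@measurable_fun_fubini_tonelli_F _ _ _ _ _ (power_prob P n) _ mGc).
rewrite PM//; last by move=> x; exact: integral_ge0.
apply: eq_integral => x _; rewrite IH//; last first.
  exact: (measurable_fun_pair2 x mGc).
rewrite muleC -ge0_integralZl//; last 3 first.
- apply: emeasurable_funM => //.
  exact: (measurable_fun_pair2 x mGc).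
- by move=> t _; rewrite mule_ge0// lee_fin prodr_ge0.
- by rewrite lee_fin.
apply: eq_integral => t _; rewrite big_ord_recl/= muleCA -EFinM.
congr (_ * (_ * _)%:E).
by apply: eq_bigr => i _; rewrite tnthS.
Qed.

(** Tensorization: the affinity bound for a sample is the power of the bound for one observation. *)
Lemma power_prob_prod (M : probability T R) (r : T -> R) (rho : R) :
  (forall x, 0 <= r x)%R -> measurable_fun [set: T] r ->
  \int[M]_x (r x)%:E = rho%:E ->
  forall n, \int[power_prob M n]_t (\prod_(i < n) r (tnth t i))%:E =
    (rho ^+ n)%:E.
Proof.
move=> r0 mr rE; have rho0 : (0 <= rho)%R.
  by rewrite -lee_fin -rE; apply: integral_ge0 => x _; rewrite lee_fin.
elim=> [|n IH].
  under eq_integral do rewrite big_ord0.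
  by rewrite integral_cst//= probability_setT mul1e expr0.
rewrite ge0_integral_power_probS; last 2 first.
- by apply/measurable_EFinP; exact: measurable_prod_tnth.
- by move=> t; rewrite lee_fin prodr_ge0.
transitivity (\int[M]_x ((rho ^+ n)%:E * (r x)%:E)).
  apply: eq_integral => x _; rewrite muleC -IH -ge0_integralZl//; last 3 first.
  - by apply/measurable_EFinP; exact: measurable_prod_tnth.
  - by move=> t _; rewrite lee_fin prodr_ge0.
  - by rewrite lee_fin.
  apply: eq_integral => t _; rewrite big_ord_recl -EFinM; congr (_ * _)%:E.
  by apply: eq_bigr => i _; rewrite tnthS.
rewrite ge0_integralZl//=.
- by rewrite rE -EFinM exprSr.
- exact/measurable_EFinP.
- by move=> x _; rewrite lee_fin.
- by rewrite lee_fin exprn_ge0.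
Qed.

End power_prob_integral.

(** * Binary regression laws *)

Lemma uniform_prob01E (R : realType) (A : set (measurableTypeR R)) :
  measurable A ->
  uniform_prob (@ltr01 R) A = lebesgue_measure (A `&` `[(0 : R), 1]).
Proof.
move=> mA; rewrite /uniform_prob integral_uniform_pdf.
rewrite (eq_integral (fun=> 1%E)).
  by rewrite integral_cst ?mul1e//; exact: measurableI.
by move=> x; rewrite inE/= in_itv/= /uniform_pdf => -[_ ->]; rewrite subr0 invr1.
Qed.

Lemma uniform_prob01_itvNyc (R : realType) (e : R) : 0 <= e <= 1 ->
  uniform_prob (@ltr01 R) `]-oo, e] = e%:E.
Proof.
move=> /andP[e0 e1]; rewrite uniform_prob01E//.
have -> : `]-oo, e]%classic `&` `[(0 : R), 1]%classic = `[0, e]%classic.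
  apply/seteqP; split=> x /=; rewrite !in_itv/=; first by case=> -> /andP[->].
  by move=> /andP[-> xe]; split=> //=; rewrite (le_trans xe).
rewrite lebesgue_measure_itv/= lte_fin sube0; case: ltP => // e0'.
by congr EFin; apply/eqP; rewrite eq_le e0 e0'.
Qed.

Section two_point_law.
Context {R : realType} {dT : measure_display} {T : measurableType dT}.
Variables (U : probability T R) (L : R) (eta : T -> R).
Hypothesis meta : measurable_fun [set: T] eta.

(** The label is drawn by comparing an independent uniform variable with [eta x]. The joint law is
    then the image of a product measure, and its integrals follow from Tonelli. *)
Definition two_point_map (p : T * measurableTypeR R) :
    T * measurableTypeR R :=
  (p.1, if p.2 <= eta p.1 then 0 else L).

Lemma measurable_two_point_map : measurable_fun [set: _] two_point_map.
Proof.
apply: measurable_fun_pair; first exact: measurable_fst.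
apply: measurable_fun_ifT => //.
apply: measurable_fun_ler; first exact: measurable_snd.
by apply: measurableT_comp => //; exact: measurable_fst.
Qed.

Definition two_point_mfun : {mfun (T * measurableTypeR R)%type >->
    (T * measurableTypeR R)%type} :=
  HB.pack two_point_map
    (isMeasurableFun.Build _ _ _ _ _ measurable_two_point_map).

Definition two_point_law : probability (T * measurableTypeR R)%type R :=
  distribution (U \x uniform_prob (@ltr01 R))%E two_point_mfun.

Hypothesis eta01 : forall x, 0 <= eta x <= 1.
Local Open Scope ereal_scope.

Lemma ge0_integral_two_point_law (G : T * measurableTypeR R -> \bar R) :
  measurable_fun [set: _] G -> (forall p, 0 <= G p) ->
  \int[two_point_law]_p G p =
  \int[U]_x ((eta x)%:E * G (x, 0%R) + (1 - eta x)%:E * G (x, L)).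
Proof.
move=> mG G0; rewrite [LHS]ge0_integral_distribution//.
rewrite (fubini_tonelli1 (G \o two_point_mfun))//; last 2 first.
- by apply: measurableT_comp => //; exact: measurable_two_point_map.
- by move=> ?; exact: G0.
apply: eq_integral => x _; have /andP[e0 e1] := eta01 x.
pose A : set (measurableTypeR R) := `]-oo, eta x]%classic.
have mA : measurable A by exact: measurable_itv.
transitivity (\int[uniform_prob (@ltr01 R)]_u
    (G (x, 0%R) * (\1_A u)%:E + G (x, L) * (\1_(~` A) u)%:E)).
  apply: eq_integral => u _; rewrite /= /two_point_map /= !indicE in_setC.
  rewrite (_ : (u \in A) = (u <= eta x)%R); last first.
    by apply/idP/idP; rewrite inE /A/= in_itv.
  by case: ifP => _ /=; rewrite mule1 mule0 ?adde0 ?add0e.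
rewrite ge0_integralD//=; last 4 first.
- by move=> u _; rewrite mule_ge0// lee_fin.
- by apply: emeasurable_funM => //; apply/measurable_EFinP; exact: measurable_indic.
- by move=> u _; rewrite mule_ge0// lee_fin.
- apply: emeasurable_funM => //; apply/measurable_EFinP.
  by apply: measurable_indic; exact: measurableC.
have mI (B : set (measurableTypeR R)) : measurable B ->
    measurable_fun [set: measurableTypeR R] (fun u => (\1_B u)%:E : \bar R).
  by move=> mB; apply/measurable_EFinP; exact: measurable_indic.
rewrite !ge0_integralZl ?lee_fin//; last 2 first.
- by apply: mI; exact: measurableC.
- exact: mI.
rewrite !integral_indic//; last exact: measurableC.
rewrite !setIT; have Ae := uniform_prob01_itvNyc (eta01 x).
congr (_ + _); rewrite muleC; congr (_ * _); first exact: Ae.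
apply: (etrans (probability_setC (uniform_prob (@ltr01 R)) mA)).
by rewrite EFinB; congr (_ - _); exact: Ae.
Qed.

End two_point_law.

Section two_point_cdf.
Context {R : realType}.
Variables (e L : R).

Definition two_point_cdf (z : R) : R :=
  e * (0 <= z)%R%:R + (1 - e) * (L <= z)%R%:R.

Hypothesis e01 : 0 <= e <= 1.

Let step_right_continuous (a : R) :
  right_continuous (fun z : R => (a <= z)%R%:R : R).
Proof.
move=> x; apply: cvg_near_cst; case: (leP a x) => ax.
  near=> z; have xz : x < z by near: z; exact: nbhs_right_gt.
  by rewrite (le_trans ax (ltW xz)).
near=> z; have za : z < a by near: z; exact: nbhs_right_lt.
by rewrite leNgt za.
Unshelve. all: by end_near. Qed.

Let step_cvgNy (a : R) : ((a <= z)%R%:R : R) @[z --> -oo] --> (0 : R).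
Proof.
apply: cvg_near_cst; near=> z.
have za : z < a by near: z; apply: nbhs_ninfty_lt; rewrite num_real.
by rewrite leNgt za.
Unshelve. all: by end_near. Qed.

Let step_cvgy (a : R) : ((a <= z)%R%:R : R) @[z --> +oo] --> (1 : R).
Proof.
apply: cvg_near_cst; near=> z.
by have -> : a <= z by near: z; apply: nbhs_pinfty_ge; rewrite num_real.
Unshelve. all: by end_near. Qed.

Let two_point_cdf_nd : nondecreasing two_point_cdf.
Proof.
have /andP[e0 e1] := e01.
have step (a x y : R) : x <= y -> ((a <= x)%R%:R : R) <= (a <= y)%R%:R.
  by move=> xy; rewrite ler_nat; case: (leP a x) => // /le_trans/(_ xy) ->.
by move=> x y xy; apply: lerD; apply: ler_wpM2l;
  rewrite ?subr_ge0//; exact: step.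
Qed.

Let two_point_cdf_rc : right_continuous two_point_cdf.
Proof.
by move=> x; apply: cvgD; (apply: cvgM; [exact: cvg_cst|exact: step_right_continuous]).
Qed.

Let two_point_cdfNy : two_point_cdf @ -oo --> (0 : R).
Proof.
rewrite -[X in _ --> X](_ : e * 0 + (1 - e) * 0 = 0); last by rewrite !mulr0 addr0.
by apply: cvgD; (apply: cvgM; [exact: cvg_cst|exact: step_cvgNy]).
Qed.

Let two_point_cdfy : two_point_cdf @ +oo --> (1 : R).
Proof.
rewrite -[X in _ --> X](_ : e * 1 + (1 - e) * 1 = 1); last by rewrite !mulr1 subrKC.
by apply: cvgD; (apply: cvgM; [exact: cvg_cst|exact: step_cvgy]).
Qed.

Definition two_point_distfun : distfun R :=
  HB.pack two_point_cdf
    (isCumulative.Build R _ R two_point_cdf two_point_cdf_nd two_point_cdf_rc)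
    (isCumulativeBounded.Build R 0 1 two_point_cdf
      two_point_cdfNy two_point_cdfy).

End two_point_cdf.

Lemma measurable_two_point_cdf (R : realType) d (T : measurableType d)
    (eta : T -> R) (L z : R) : measurable_fun [set: T] eta ->
  measurable_fun [set: T] (fun x => two_point_cdf (eta x) L z).
Proof.
move=> meta; apply: measurable_funD; apply: measurable_funM => //.
exact: measurable_funB.
Qed.

(** * CRPS risk of binary regression models *)

Section crps.
Context {R : realType} {dT : measure_display} {T : measurableType dT}.
Variables (F : T -> distfun R) (L : R).
Hypothesis mF : forall z, measurable_fun [set: T] (fun t => F t z).
Hypothesis L0 : 0 < L.
Local Open Scope ereal_scope.

Lemma measurable_CRPS :
  measurable_fun [set: T * measurableTypeR R] (fun p => CRPS (F p.1) p.2).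
Proof.
have mg : measurable_fun [set: (T * measurableTypeR R) * measurableTypeR R]
    (fun q => (((F q.1.1 q.2 - (q.1.2 <= q.2)%R%:R) ^+ 2)%R)%:E : \bar R).
  apply/measurable_EFinP; apply: measurable_funX; apply: measurable_funB.
    have mtz : measurable_fun [set: (T * measurableTypeR R) * measurableTypeR R]
        (fun q => (q.1.1, q.2)).
      apply: measurable_fun_pair; last exact: measurable_snd.
      exact: (measurableT_comp measurable_fst measurable_fst).
    exact: (measurableT_comp (measurable_distfun_pair mF) mtz).
  have mle : measurable_fun [set: (T * measurableTypeR R) * measurableTypeR R]
      (fun q => (q.1.2 <= q.2 :> R)%R).
    apply: measurable_fun_ler; last exact: measurable_snd.
    exact: (measurableT_comp measurable_snd measurable_fst).
  rewrite (_ : (fun _ => _) = fun q : (T * measurableTypeR R) * measurableTypeR R =>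
      if (q.1.2 <= q.2 :> R)%R then 1%R else 0%R); last first.
    by apply/funext => q; case: ifP.
  exact: measurable_fun_ifT.
apply: (@measurable_fun_fubini_tonelli_F _ _ _ _ _ lebesgue_measure _ mg).
by move=> x; rewrite lee_fin sqr_ge0.
Qed.

Lemma CRPS_ge0 (G : distfun R) y : 0 <= CRPS G y.
Proof. by apply: integral_ge0 => z _; rewrite lee_fin sqr_ge0. Qed.

(** Squared L^2 distance, restricted to [[0, L[], from [G] to the distribution function of the law
    with mass [e] at 0 and [1 - e] at [L], which equals [e] there. The loss thus depends on a single
    number. *)
Definition binary_L2 (G : R -> R) (e : R) : \bar R :=
  \int[lebesgue_measure]_z (\1_(`[0%R, L[) z * (G z - e) ^+ 2)%:E.

Lemma measurable_distfun (G : distfun R) : measurable_fun [set: R] G.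
Proof.
by apply: nondecreasing_measurable => //; exact: cumulative_is_nondecreasing.
Qed.

Let measurable_crps_integrand (G : distfun R) (y : R) :
  measurable_fun [set: measurableTypeR R] (fun z => ((G z - (y <= z)%R%:R) ^+ 2)%R).
Proof.
apply: measurable_funX; apply: measurable_funB; first exact: measurable_distfun.
apply: nondecreasing_measurable => // a b ab.
by rewrite ler_nat; case: (leP y a) => // /le_trans/(_ ab) ->.
Qed.

Lemma mean_CRPSE (G : distfun R) (e : R) : (0 <= e <= 1)%R ->
  e%:E * CRPS G 0%R + (1 - e)%:E * CRPS G L =
  \int[lebesgue_measure]_z (e * (G z - (0 <= z)%R%:R) ^+ 2 +
                            (1 - e) * (G z - (L <= z)%R%:R) ^+ 2)%:E.
Proof.
move=> /andP[e0 e1]; rewrite /CRPS -!ge0_integralZl ?lee_fin ?subr_ge0//.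
- rewrite -ge0_integralD//.
  + by move=> z _; rewrite lee_fin mulr_ge0// sqr_ge0.
  + by apply/measurable_EFinP; exact: measurable_funM.
  + by move=> z _; rewrite lee_fin mulr_ge0// ?sqr_ge0 ?subr_ge0.
  + by apply/measurable_EFinP; exact: measurable_funM.
- by apply/measurable_EFinP.
- by move=> z _; rewrite lee_fin sqr_ge0.
- by apply/measurable_EFinP.
- by move=> z _; rewrite lee_fin sqr_ge0.
Qed.

Lemma measurable_binary_L2_integrand (G : distfun R) (e : R) :
  measurable_fun [set: measurableTypeR R]
    (fun z => (\1_(`[0%R, L[) z * (G z - e) ^+ 2)%R).
Proof.
apply: measurable_funM; first exact: measurable_indic.
by apply: measurable_funX; apply: measurable_funB => //; exact: measurable_distfun.
Qed.

Let binary_L2D (G : distfun R) (e : R) : (0 <= e <= 1)%R ->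
  \int[lebesgue_measure]_z
    (\1_(`[0%R, L[) z * ((G z - e) ^+ 2 + e * (1 - e)))%:E =
  binary_L2 G e + (L * (e * (1 - e)))%:E.
Proof.
move=> /andP[e0 e1]; have v0 : (0 <= e * (1 - e))%R by rewrite mulr_ge0// subr_ge0.
under eq_integral do rewrite mulrDr EFinD.
rewrite ge0_integralD//; last 4 first.
- by move=> z _; rewrite lee_fin mulr_ge0// sqr_ge0.
- by apply/measurable_EFinP; exact: measurable_binary_L2_integrand.
- by move=> z _; rewrite lee_fin mulr_ge0.
- by apply/measurable_EFinP; apply: measurable_funM => //; exact: measurable_indic.
congr (_ + _); under eq_integral do rewrite mulrC EFinM.
rewrite ge0_integralZl ?lee_fin//; last first.
  by apply/measurable_EFinP; exact: measurable_indic.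
rewrite integral_indic//= setIT lebesgue_measure_itv/= lte_fin L0 sube0.
by rewrite -EFinM mulrC.
Qed.

(** Bias-variance decomposition: on [[0, L[] the integrand is e (G - 1)^2 + (1 - e) G^2 = (G - e)^2
    + e (1 - e). Off this interval it is nonnegative and is dropped. *)
Lemma mean_CRPS_ge (G : distfun R) (e : R) : (0 <= e <= 1)%R ->
  binary_L2 G e + (L * (e * (1 - e)))%:E <=
  e%:E * CRPS G 0%R + (1 - e)%:E * CRPS G L.
Proof.
move=> e01; rewrite mean_CRPSE// -binary_L2D//; have /andP[e0 e1] := e01.
apply: ge0_le_integral => //.
- by move=> z _; rewrite lee_fin mulr_ge0// addr_ge0 ?sqr_ge0// mulr_ge0// subr_ge0.
- apply/measurable_EFinP; apply: measurable_funM; first exact: measurable_indic.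
  apply: measurable_funD => //.
  by apply: measurable_funX; apply: measurable_funB => //; exact: measurable_distfun.
- apply/measurable_EFinP; apply: measurable_funD; exact: measurable_funM.
- move=> z _; rewrite lee_fin indicE mem_setE in_itv/=.
  case: (leP 0%R z) => z0; case: (ltP z L) => zL /=; rewrite ?mul0r ?mul1r.
  + by rewrite le_eqVlt; apply/orP; left; apply/eqP; ring.
  + by rewrite addr_ge0// mulr_ge0 ?sqr_ge0 ?subr_ge0.
  + by rewrite addr_ge0// mulr_ge0 ?sqr_ge0 ?subr_ge0.
  + by rewrite addr_ge0// mulr_ge0 ?sqr_ge0 ?subr_ge0.
Qed.

(** The true distribution function attains the variance term: its bias vanishes on [[0, L[], and
    elsewhere it coincides with both step functions. Subtracting this value leaves only
    [binary_L2]. *)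
Lemma mean_CRPS_two_point (e : R) (e01 : (0 <= e <= 1)%R) :
  e%:E * CRPS (two_point_distfun L e01) 0%R +
    (1 - e)%:E * CRPS (two_point_distfun L e01) L = (L * (e * (1 - e)))%:E.
Proof.
rewrite mean_CRPSE// -[RHS]add0e.
rewrite -[X in X + _](_ : binary_L2 (two_point_distfun L e01) e = 0).
  rewrite -binary_L2D//; apply: eq_integral => z _; rewrite indicE mem_setE in_itv/=.
  congr EFin; rewrite /two_point_cdf.
  case: (leP 0%R z) => z0; case: (leP L z) => zL /=; try ring.
  by move: (lt_le_trans z0 (le_trans (ltW L0) zL)); rewrite ltxx.
rewrite /binary_L2 integral0_eq// => z _.
rewrite indicE mem_setE in_itv/= /two_point_cdf.
by case: (leP 0%R z) => z0; case: (leP L z) => zL /=; congr EFin; ring.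
Qed.

End crps.

(** The two functions differ by the constant [e' - e] on an interval of length [L] and agree
    elsewhere. This is the source of the factor [Num.sqrt L] in the Hoelder condition on [eta]. *)
Lemma Lnorm2_two_point_cdf (R : realType) (L e e' : R) : 0 < L ->
  ('N[lebesgue_measure]_2%:E
     [(fun z => (two_point_cdf e' L z - two_point_cdf e L z)%:E)] =
  (`|e' - e| * Num.sqrt L)%:E)%E.
Proof.
move=> L0; rewrite unlock.
transitivity ((((`|e' - e| ^+ 2) * L)%:E `^ 2^-1)%E); last first.
  rewrite poweR12_sqrt ?lee_fin ?(mulr_ge0 (sqr_ge0 _) (ltW L0))//=.
  by rewrite sqrtrM ?sqr_ge0// sqrtr_sqr normr_id.
apply: (congr1 (fun t : \bar R => (t `^ 2^-1)%E)).
transitivity (\int[lebesgue_measure]_z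
    ((`|e' - e| ^+ 2)%:E * (\1_(`[0%R, L[) z)%:E))%E.
  apply: eq_integral => z _; rewrite abse_EFin poweR_EFin -EFinM; congr EFin.
  rewrite powR_mulrn// indicE mem_setE in_itv/= /two_point_cdf.
  case: (leP 0%R z) => z0; case: (leP L z) => zL /=.
  - by rewrite (_ : _ - _ = 0) ?normr0 ?expr0n ?mulr0//; ring.
  - by rewrite (_ : _ - _ = e' - e) ?mulr1//; ring.
  - by rewrite (_ : _ - _ = 0) ?normr0 ?expr0n ?mulr0//;
      move: (lt_le_trans z0 (le_trans (ltW L0) zL)); rewrite ltxx.
  - by rewrite (_ : _ - _ = 0) ?normr0 ?expr0n ?mulr0//; ring.
rewrite ge0_integralZl ?lee_fin ?sqr_ge0//; last first.
  by apply/measurable_EFinP; exact: measurable_indic.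
by rewrite integral_indic//= setIT lebesgue_measure_itv/= lte_fin L0 sube0.
Qed.

Lemma measure_integral_indic {R : realType} {dT : measure_display}
    {T : measurableType dT} (mu : {measure set T -> \bar R}) (A : set T) :
  measurable A -> mu A = (\int[mu]_x (\1_A x)%:E)%E.
Proof. by move=> mA; rewrite integral_indic// setIT. Qed.

Lemma ge0_integralD_cst {R : realType} {dT : measure_display}
    {T : measurableType dT} (P : probability T R) (f : T -> \bar R)
    (c : \bar R) :
  measurable_fun [set: T] f -> (forall x, 0 <= f x)%E -> (0 <= c)%E ->
  (\int[P]_x (f x + c) = \int[P]_x f x + c)%E.
Proof.
move=> mf f0 c0; rewrite ge0_integralD// integral_cst//.
by rewrite [X in (_ * X)%E](_ : _ = 1%E) ?mule1//; exact: probability_setT.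
Qed.

(** * Two-point laws as members of the class, and their excess risk *)

Section two_point_model.
Context {R : realType} {d : nat}.
Variables (L : R) (eta : covariate R d -> R).
Hypothesis L0 : 0 < L.
Hypothesis meta : measurable_fun [set: covariate R d] eta.
Hypothesis eta01 : forall x, 0 <= eta x <= 1.

Let U := uniform_cube R d.
Let P : probability (observation R d) R := two_point_law U L meta.
Let Fstar (x : covariate R d) : distfun R := two_point_distfun L (eta01 x).

Lemma two_point_law_support :
  P ([set: covariate R d] `*` [set (0 : R); L]) = 1%E.
Proof.
pose S : set (observation R d) := [set: covariate R d] `*` [set (0 : R); L].
transitivity ((U \x uniform_prob (@ltr01 R))%E (two_point_map L eta @^-1` S)) => //.
have -> : two_point_map L eta @^-1` S = setT; last exact: probability_setT.
apply/seteqP; split => // -[x u] _ /=; split => //=.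
by case: ifP => _; [left|right].
Qed.

Lemma marginal_two_point_law A : measurable A -> marginal_law P A = U A.
Proof.
move=> mA; transitivity ((U \x uniform_prob (@ltr01 R))%E (A `*` setT)).
  rewrite /marginal_law /P /two_point_law /distribution /pushforward/=.
  by congr (_ _); apply/seteqP; split => -[x u]//= -[].
rewrite product_measure1E//; transitivity (U A * 1)%E; last by rewrite mule1.
by congr (_ * _)%E; exact: probability_setT.
Qed.

Lemma two_point_law_cond_cdf : is_cond_cdf P Fstar.
Proof.
split=> [y|A y mA]; first exact: measurable_two_point_cdf.
rewrite (eq_measure_integral U) => [|B mB _]; last exact: marginal_two_point_law.
have mS : measurable (A `*` `]-oo, y]%classic : set (observation R d)).
  by apply: measurableX => //; exact: measurable_itv.
transitivity (\int[P]_p (\1_(A `*` `]-oo, y]%classic) p)%:E)%E.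
  exact: measure_integral_indic.
rewrite ge0_integral_two_point_law ?lee_fin//; last first.
  by apply/measurable_EFinP; exact: measurable_indic.
rewrite [RHS]integral_mkcond; apply: eq_integral => x _.
rewrite patchE !indicE/= -!EFinM -EFinD.
have inS r : ((x, r) \in A `*` `]-oo, y]%classic) = (x \in A) && (r <= y).
  by apply/idP/andP; rewrite !inE/= in_itv/= => -[].
rewrite !inS; by case: (x \in A); rewrite /= ?mulr0 ?addr0.
Qed.

Lemma two_point_law_class_B (h C : R) :
  (forall x x', cube x -> cube x' ->
    `|eta x' - eta x| * Num.sqrt L <= C * euclid_dist x' x `^ h) ->
  class_B h C L P.
Proof.
move=> etaH; split.
- exact: two_point_law_support.
- exact: marginal_two_point_law.
- exists Fstar; first exact: two_point_law_cond_cdf.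
  move=> x x' cx cx'; rewrite Lnorm2_two_point_cdf// lee_fin.
  exact: etaH.
Qed.

Local Open Scope ereal_scope.

Lemma risk_two_point_law (F : covariate R d -> distfun R) :
  (forall z, measurable_fun [set: covariate R d] (fun x => F x z)) ->
  risk P F = \int[U]_x ((eta x)%:E * CRPS (F x) 0%R +
                        (1 - eta x)%:E * CRPS (F x) L).
Proof.
move=> mF; rewrite /risk ge0_integral_two_point_law//.
- exact: measurable_CRPS.
- by move=> p; exact: CRPS_ge0.
Qed.

Let v x : R := (L * (eta x * (1 - eta x)))%R.

Let v_ge0 x : (0 <= v x)%R.
Proof.
by have /andP[? ?] := eta01 x; rewrite /v mulr_ge0// ?(ltW L0)// mulr_ge0 ?subr_ge0.
Qed.

Let mv : measurable_fun [set: covariate R d] v.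
Proof.
apply: measurable_funM => //; apply: measurable_funM => //.
exact: measurable_funB.
Qed.

Lemma risk_two_point_cond_cdf : risk P Fstar = \int[U]_x (v x)%:E.
Proof.
rewrite risk_two_point_law => [|z]; last exact: measurable_two_point_cdf.
by apply: eq_integral => x _; exact: mean_CRPS_two_point.
Qed.

(** Needed to move the subtracted risk to the other side of an inequality in the extended reals. The
    variance term is at most [L]. *)
Lemma risk_two_point_cond_cdf_fin_num : risk P Fstar \is a fin_num.
Proof.
rewrite risk_two_point_cond_cdf ge0_fin_numE; last first.
  by apply: integral_ge0 => x _; rewrite lee_fin.
apply: (@le_lt_trans _ _ (\int[U]_x L%:E)); last first.
  rewrite integral_cst//= [X in _ * X](_ : _ = 1) ?mule1 ?ltry//.
  exact: probability_setT.
apply: ge0_le_integral => //.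
- by move=> x _; rewrite lee_fin.
- exact/measurable_EFinP.
- move=> x _; rewrite lee_fin -[leRHS]mulr1; apply: ler_wpM2l (ltW L0) _ _ _.
  have /andP[e0 e1] := eta01 x; rewrite -[leRHS]mulr1.
  by apply: ler_pM; rewrite ?subr_ge0// lerBlDr lerDl.
Qed.

Lemma measurable_binary_L2 {d' : measure_display} {T : measurableType d'}
    (F : T -> distfun R) (e : T -> R) :
  (forall z, measurable_fun [set: T] (fun t => F t z)) ->
  measurable_fun [set: T] e ->
  measurable_fun [set: T] (fun t => binary_L2 L (F t) (e t)).
Proof.
move=> mF me.
have mg : measurable_fun [set: T * measurableTypeR R]
    (fun p => (\1_(`[0%R, L[) p.2 * (F p.1 p.2 - e p.1) ^+ 2)%:E : \bar R).
  apply/measurable_EFinP; apply: measurable_funM.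
    by apply: measurableT_comp => //.
  apply: measurable_funX; apply: measurable_funB.
    exact: measurable_distfun_pair.
  by apply: measurableT_comp => //; exact: measurable_fst.
apply: (@measurable_fun_fubini_tonelli_F _ _ _ _ _ lebesgue_measure _ mg).
by move=> x; rewrite lee_fin mulr_ge0// sqr_ge0.
Qed.

Lemma binary_L2_ge0 (G : R -> R) e : 0 <= binary_L2 L G e.
Proof. by apply: integral_ge0 => z _; rewrite lee_fin mulr_ge0// sqr_ge0. Qed.

(** The risk of [Fstar] is added inside the integral over the samples, which has total mass 1. The
    bias-variance bound is then applied at each [D] and [x]. *)
Lemma excess_risk_two_point_law_ge n
    (Fhat : n.-tuple (observation R d) -> covariate R d -> distfun R) :
  is_predictor Fhat ->
  \int[power_prob P n]_D \int[U]_x binary_L2 L (Fhat D x) (eta x) <=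
  excess_risk P Fhat Fstar.
Proof.
move=> mFhat; rewrite /excess_risk leeBrDr ?risk_two_point_cond_cdf_fin_num//.
have mB : measurable_fun [set: n.-tuple (observation R d) * covariate R d]
    (fun p => binary_L2 L (Fhat p.1 p.2) (eta p.2)).
  apply: (measurable_binary_L2 (F := fun p => Fhat p.1 p.2)) => //.
  by apply: measurableT_comp => //; exact: measurable_snd.
have mFD D z : measurable_fun [set: covariate R d] (fun x => Fhat D x z).
  exact: (measurable_fun_pair2 D (mFhat z)).
have mBD D : measurable_fun [set: covariate R d]
    (fun x => binary_L2 L (Fhat D x) (eta x)).
  exact: (measurable_fun_pair2 D mB).
have mIB : measurable_fun [set: n.-tuple (observation R d)]
    (fun D => \int[U]_x binary_L2 L (Fhat D x) (eta x)).
  apply: (@measurable_fun_fubini_tonelli_F _ _ _ _ _ U _ mB).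
  by move=> x; exact: binary_L2_ge0.
have mrisk : measurable_fun [set: n.-tuple (observation R d)]
    (fun D => risk P (Fhat D)).
  have mg : measurable_fun [set: n.-tuple (observation R d) * observation R d]
      (fun q => CRPS (Fhat q.1 q.2.1) q.2.2).
    have mh : measurable_fun [set: n.-tuple (observation R d) * observation R d]
        (fun q => ((q.1, q.2.1), q.2.2)).
      apply: measurable_fun_pair; last first.
        exact: (measurableT_comp measurable_snd measurable_snd).
      apply: measurable_fun_pair; first exact: measurable_fst.
      exact: (measurableT_comp measurable_fst measurable_snd).
    exact: (measurableT_comp (measurable_CRPS mFhat) mh).
  apply: (@measurable_fun_fubini_tonelli_F _ _ _ _ _ P _ mg).
  by move=> q; exact: CRPS_ge0.
have r0 : 0 <= risk P Fstar.
  by rewrite risk_two_point_cond_cdf; apply: integral_ge0 => x _; rewrite lee_fin.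
have IB0 D : 0 <= \int[U]_x binary_L2 L (Fhat D x) (eta x).
  by apply: integral_ge0 => x _; exact: binary_L2_ge0.
rewrite -(ge0_integralD_cst (power_prob P n) mIB IB0 r0).
have mIBr : measurable_fun [set: n.-tuple (observation R d)]
    (fun D => \int[U]_x binary_L2 L (Fhat D x) (eta x) + risk P Fstar).
  exact: emeasurable_funD mIB (measurable_cst _).
apply: (@ge0_le_integral _ _ _ _ _ measurableT _ _ _ mIBr mrisk).
  by move=> D _; exact: adde_ge0.
move=> D _; rewrite risk_two_point_cond_cdf risk_two_point_law//.
rewrite -ge0_integralD//; last 3 first.
- by move=> x _; exact: binary_L2_ge0.
- by move=> x _; rewrite lee_fin.
- exact/measurable_EFinP.
have mC y : measurable_fun [set: covariate R d] (fun x => CRPS (Fhat D x) y).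
  exact: (measurable_fun_pair1 y (measurable_CRPS (mFD D))).
apply: ge0_le_integral => //.
- by move=> x _; rewrite adde_ge0 ?binary_L2_ge0// lee_fin.
- by apply: emeasurable_funD => //; exact/measurable_EFinP.
- apply: emeasurable_funD; apply: emeasurable_funM; try exact: mC.
    exact/measurable_EFinP.
  by apply/measurable_EFinP; exact: measurable_funB.
- by move=> x _; exact: mean_CRPS_ge.
Qed.

End two_point_model.

(** * Two-point inequalities *)

(** For fixed u - v and S = p + q > 0, the least value of p u^2 + q v^2 is (p q / S) (u - v)^2,
    which is at least (r^2 / S) (u - v)^2; and r^2 / S + S / 4 >= r by AM-GM. With [p], [q]
    likelihoods and [r] below their geometric mean, integration gives Le Cam's two-point bound in
    terms of the affinity. *)
Lemma le_weighted_sqr (R : realFieldType) (p q r u v : R) :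
  0 <= p -> 0 <= q -> 0 <= r -> r ^+ 2 <= p * q ->
  (u - v) ^+ 2 * r <= p * u ^+ 2 + q * v ^+ 2 + (u - v) ^+ 2 / 4 * (p + q).
Proof.
move=> p0 q0 r0 rpq.
have [S0|S0] := eqVneq (p + q) 0.
  have p00 : p = 0 by lra.
  have q00 : q = 0 by lra.
  have -> : r = 0.
    by apply/eqP; rewrite -sqrf_eq0 eq_le sqr_ge0 andbT (le_trans rpq)// p00 mul0r.
  by rewrite p00 q00 !mul0r mulr0 !add0r mulr0.
have {}S0 : 0 < p + q by rewrite lt_neqAle eq_sym S0 addr_ge0.
rewrite -(ler_pM2l S0) -subr_ge0.
have -> : (p + q) * (p * u ^+ 2 + q * v ^+ 2 + (u - v) ^+ 2 / 4 * (p + q)) -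
    (p + q) * ((u - v) ^+ 2 * r) =
    (p * u + q * v) ^+ 2 + (u - v) ^+ 2 * (p * q - r ^+ 2) +
    (u - v) ^+ 2 * ((p + q) / 2 - r) ^+ 2 by field.
by rewrite !addr_ge0 ?sqr_ge0// mulr_ge0 ?sqr_ge0// subr_ge0.
Qed.

(** Bernoulli's inequality, which makes the affinity of n observations linear in n. *)
Lemma expr1B_ge (R : realDomainType) (t : R) n :
  0 <= t <= 1 -> 1 - n%:R * t <= (1 - t) ^+ n.
Proof.
move=> /andP[t0 t1]; elim: n => [|n IH]; first by rewrite mul0r subr0.
rewrite exprS; apply: (@le_trans _ _ ((1 - t) * (1 - n%:R * t))).
  rewrite -subr_ge0 -[n.+1]addn1 natrD.
  have -> : (1 - t) * (1 - n%:R * t) - (1 - (n%:R + 1) * t) = n%:R * (t * t) by ring.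
  by rewrite mulr_ge0// mulr_ge0.
by rewrite ler_wpM2l// subr_ge0.
Qed.

(** The scalar inequality with u = G z - e and v = G z - e', integrated over [[0, L[]. The
    difference u - v does not depend on z, whence the explicit factors [L]. *)
Lemma binary_L2_weighted (R : realType) (L : R) (G : distfun R)
    (p q r e e' : R) : 0 < L -> 0 <= p -> 0 <= q -> 0 <= r -> r ^+ 2 <= p * q ->
  ((L * ((e - e') ^+ 2 * r))%:E <= p%:E * binary_L2 L G e +
     q%:E * binary_L2 L G e' + (L * ((e - e') ^+ 2 / 4 * (p + q)))%:E)%E.
Proof.
move=> L0 p0 q0 r0 rpq.
have I_ge0 z : 0 <= (\1_(`[0%R, L[) z : R) by [].
have mI : measurable_fun [set: measurableTypeR R] (\1_(`[0%R, L[) : _ -> R).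
  exact: measurable_indic.
have intc (c : R) : 0 <= c ->
    (L * c)%:E = (\int[lebesgue_measure]_z (\1_(`[0%R, L[) z * c)%:E)%E.
  move=> c0; under eq_integral do rewrite mulrC EFinM.
  rewrite ge0_integralZl ?lee_fin//; last exact/measurable_EFinP.
  rewrite integral_indic//= setIT lebesgue_measure_itv/= lte_fin L0 sube0.
  by rewrite -EFinM mulrC.
have c0 : 0 <= (e - e') ^+ 2 / 4 * (p + q).
  by rewrite mulr_ge0 ?addr_ge0// divr_ge0// sqr_ge0.
have mL2 f : measurable_fun [set: measurableTypeR R]
    (fun z => (\1_(`[0%R, L[) z * (G z - f) ^+ 2)%:E).
  by apply/measurable_EFinP; exact: measurable_binary_L2_integrand.
have L2_ge0 f z : (0 <= (\1_(`[0%R, L[) z * (G z - f) ^+ 2)%:E)%E.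
  by rewrite lee_fin mulr_ge0// sqr_ge0.
have mc c : measurable_fun [set: measurableTypeR R]
    (fun z => (\1_(`[0%R, L[) z * c)%:E).
  by apply/measurable_EFinP; exact: measurable_funM.
rewrite (intc _ c0) intc; last by rewrite mulr_ge0// sqr_ge0.
rewrite /binary_L2.
rewrite -!ge0_integralZl ?lee_fin//.
have mpL2 (c : R) f : measurable_fun [set: measurableTypeR R]
    (fun z => (c%:E * (\1_(`[0%R, L[) z * (G z - f) ^+ 2)%:E)%E).
  by apply: emeasurable_funM => //; exact: mL2.
rewrite -ge0_integralD//; last 2 first.
- by move=> z _; rewrite mule_ge0.
- by move=> z _; rewrite mule_ge0.
rewrite -ge0_integralD//; last 3 first.
- by move=> z _; rewrite adde_ge0// mule_ge0.
- exact: emeasurable_funD.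
- by move=> z _; rewrite lee_fin mulr_ge0.
apply: ge0_le_integral => //.
- by move=> z _; rewrite lee_fin mulr_ge0// mulr_ge0 ?sqr_ge0.
- by apply: emeasurable_funD => //; exact: emeasurable_funD.
move=> z _; rewrite -!EFinM -!EFinD lee_fin.
have /(ler_wpM2l (I_ge0 z)) zle :=
  le_weighted_sqr (G z - e) (G z - e') p0 q0 r0 rpq.
by apply: le_trans (le_trans zle _); rewrite le_eqVlt; apply/orP; left;
  apply/eqP; ring.
Qed.

(** * Assouad's method over a finite family of cells *)

Section assouad.
Context {R : realType} {d : nat} {I : finType}.
Variables (L a : R) (cell : covariate R d -> I) (g : covariate R d -> R).
Hypothesis L0 : 0 < L.
Hypothesis a01 : 0 <= a <= 1.
Hypothesis mcell : forall k, measurable (cell @^-1` [set k]).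
Hypothesis mg : measurable_fun [set: covariate R d] g.
Hypothesis g01 : forall x, 0 <= g x <= 2^-1.

Definition bump_regression (s : {ffun I -> bool}) (x : covariate R d) : R :=
  2^-1 + (if s (cell x) then a * g x else - (a * g x)).

Lemma bump_regression01 s x : 0 <= bump_regression s x <= 1.
Proof.
have /andP[a0 a1] := a01; have /andP[g0 g1] := g01 x.
have ag0 : 0 <= a * g x by rewrite mulr_ge0.
have ag1 : a * g x <= 2^-1 by rewrite (le_trans _ g1)// ler_piMl.
by rewrite /bump_regression; case: ifP => _; apply/andP; split; lra.
Qed.

Lemma measurable_pred_cell (p : pred I) :
  measurable_fun [set: covariate R d] (fun x => p (cell x)).
Proof.
apply: (measurable_fun_bool true); rewrite setTI.
rewrite (_ : _ @^-1` _ = \bigcup_(k in [set k | p k]) (cell @^-1` [set k])).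
  by apply: fin_bigcup_measurable => [|k _]; [exact: finite_finset|exact: mcell].
by apply/seteqP; split => [x /= px|x [k /= pk ->]//]; exists (cell x).
Qed.

Lemma measurable_bump_regression s :
  measurable_fun [set: covariate R d] (bump_regression s).
Proof.
have mag : measurable_fun [set: covariate R d] (fun x => a * g x).
  exact: measurable_funM.
apply: measurable_funD => //; apply: measurable_fun_ifT => //.
  exact: measurable_pred_cell.
exact: measurable_funN.
Qed.

Let U := uniform_cube R d.

Definition bump_law s : probability (observation R d) R :=
  two_point_law U L (measurable_bump_regression s).

Let half (x : covariate R d) : R := 2^-1.
Let mhalf : measurable_fun [set: covariate R d] half.
Proof. exact: measurable_cst. Qed.
Let half01 x : 0 <= half x <= 1.
Proof. by rewrite /half; apply/andP; split; lra. Qed.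

Let M : probability (observation R d) R := two_point_law U L mhalf.

(** Density of [bump_law s] with respect to [M]: under [M] each label has probability 1/2, hence the
    factor 2. As [L] is nonzero, the test on 0 separates the two labels. *)
Definition bump_density s (p : observation R d) : R :=
  2 * if (p.2 : R) == 0 then bump_regression s p.1
      else 1 - bump_regression s p.1.

Lemma bump_density_ge0 s p : 0 <= bump_density s p.
Proof.
have /andP[e0 e1] := bump_regression01 s p.1.
by rewrite mulr_ge0//; case: ifP => _ //; rewrite subr_ge0.
Qed.

Lemma measurable_snd_eq0 :
  measurable_fun [set: observation R d] (fun p => (p.2 : R) == 0).
Proof. by apply: measurable_fun_eqr => //; exact: measurable_snd. Qed.

Lemma measurable_bump_density s :
  measurable_fun [set: observation R d] (bump_density s).
Proof.
have me : measurable_fun [set: observation R d] (fun p => bump_regression s p.1).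
  exact: measurableT_comp (measurable_bump_regression s) measurable_fst.
apply: measurable_funM => //; apply: measurable_fun_ifT => //.
  exact: measurable_snd_eq0.
exact: measurable_funB.
Qed.

Local Open Scope ereal_scope.

Lemma integral_bump_law s (G : observation R d -> \bar R) :
  measurable_fun [set: _] G -> (forall p, 0 <= G p) ->
  \int[bump_law s]_p G p = \int[M]_p (G p * (bump_density s p)%:E).
Proof.
move=> mG G0.
have mGw : measurable_fun [set: observation R d]
    (fun p => G p * (bump_density s p)%:E).
  apply: emeasurable_funM => //; apply/measurable_EFinP.
  exact: measurable_bump_density.
have Gw0 p : 0 <= G p * (bump_density s p)%:E.
  by rewrite mule_ge0// lee_fin bump_density_ge0.
apply: etrans (ge0_integral_two_point_law U L (measurable_bump_regression s)
  (bump_regression01 s) mG G0) _.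
apply: etrans (esym (ge0_integral_two_point_law U L mhalf half01 mGw Gw0)).
apply: eq_integral => x _; rewrite /bump_density/= eqxx (gt_eqF L0) /half.
have c (t : R) (y : \bar R) : t%:E * y = (2^-1)%:E * (y * (2 * t)%:E).
  by rewrite [y * _]muleC muleA -EFinM; congr (_%:E * _); field.
by rewrite c; congr (_ + _); rewrite c; congr (_%:E * _); field.
Qed.

Definition flip (s : {ffun I -> bool}) (k : I) : {ffun I -> bool} :=
  [ffun c => (c == k) (+) s c].

Lemma flipK k : involutive (flip^~ k).
Proof. by move=> s; apply/ffunP => c; rewrite !ffunE addbA addbb. Qed.

(* A product-friendly minorant of sqrt (bump_density s * bump_density (flip s k)),
   whose integral is explicit. *)
Definition bump_affinity s k (p : observation R d) : R :=
  (if cell p.1 == k then 1 - a ^+ 2 else bump_density s p)%R.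

Let a2_le1 : (0 <= 1 - a ^+ 2)%R.
Proof. by have /andP[a0 a1] := a01; rewrite subr_ge0 exprn_ile1. Qed.

Lemma bump_affinity_ge0 s k p : (0 <= bump_affinity s k p)%R.
Proof. by rewrite /bump_affinity; case: ifP => // _; exact: bump_density_ge0. Qed.

Lemma measurable_bump_affinity s k :
  measurable_fun [set: observation R d] (bump_affinity s k).
Proof.
apply: measurable_fun_ifT => //; last exact: measurable_bump_density.
exact: measurableT_comp (measurable_pred_cell (pred1 k)) measurable_fst.
Qed.

(** Off the cell [k] the two densities coincide. In it they are 1 + 2t and 1 - 2t up to order, where
    t = a g, and their product 1 - 4 t^2 is at least 1 - a^2 because g <= 1/2; finally 1 - a^2 >= (1
    - a^2)^2. *)
Lemma bump_affinity_sqr s k p :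
  (bump_affinity s k p ^+ 2 <= bump_density s p * bump_density (flip s k) p)%R.
Proof.
have /andP[a0 a1] := a01; have /andP[g0 g1] := g01 p.1.
rewrite /bump_affinity /bump_density /bump_regression ffunE.
case: eqP => [_|_]; last by rewrite addFb expr2.
set t := (a * g p.1)%R.
have t2 : (4 * t ^+ 2 <= a ^+ 2)%R.
  rewrite /t exprMn mulrCA ler_piMr ?sqr_ge0//.
  have : (g p.1 ^+ 2 <= 2^-1 ^+ 2)%R by rewrite ler_sqr ?nnegrE.
  by move=> ?; lra.
apply: (@le_trans _ _ (1 - a ^+ 2)%R).
  by rewrite expr2 ler_piMl// lerBlDr lerDl sqr_ge0.
apply: (@le_trans _ _ (1 - 4 * t ^+ 2)%R); first by rewrite lerB.
rewrite le_eqVlt; apply/orP; left; apply/eqP.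
by case: ifP => _; case: (s _) => /=; field.
Qed.

(** At each x off the cell the density averages to 1 over the label. The integral is therefore (1 -
    a^2) u + (1 - u). *)
Lemma integral_bump_affinity s k (u : R) : U (cell @^-1` [set k]) = u%:E ->
  \int[M]_p (bump_affinity s k p)%:E = (1 - a ^+ 2 * u)%:E.
Proof.
move=> uE.
have mr : measurable_fun [set: observation R d]
    (fun p => (bump_affinity s k p)%:E).
  by apply/measurable_EFinP; exact: measurable_bump_affinity.
have r0 p : 0 <= (bump_affinity s k p)%:E by rewrite lee_fin bump_affinity_ge0.
apply: etrans (ge0_integral_two_point_law U L mhalf half01 mr r0) _.
set A := cell @^-1` [set k]; have mA : measurable A by exact: mcell.
transitivity (\int[U]_x ((1 - a ^+ 2)%:E * (\1_A x)%:E + (\1_(~` A) x)%:E)).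
  apply: eq_integral => x _; rewrite /bump_affinity/= /bump_density/= eqxx (gt_eqF L0).
  rewrite -!EFinM -!EFinD !indicE in_setC /half; congr EFin.
  rewrite (_ : (x \in A) = (cell x == k)); last by apply/idP/eqP; rewrite inE.
  by case: ifP => _ /=; field.
rewrite ge0_integralD//; last 3 first.
- by move=> x _; rewrite mule_ge0// lee_fin.
- by apply: emeasurable_funM => //; apply/measurable_EFinP; exact: measurable_indic.
- by apply/measurable_EFinP; apply: measurable_indic; exact: measurableC.
rewrite ge0_integralZl ?lee_fin//; last first.
  by apply/measurable_EFinP; exact: measurable_indic.
rewrite !integral_indic//; last exact: measurableC.
rewrite !setIT [X in _ + X](probability_setC U mA).
transitivity ((1 - a ^+ 2)%:E * u%:E + (1 - u%:E)).
  by congr (_ * _ + (_ - _)).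
by rewrite -EFinM -EFinB -EFinD; congr EFin; ring.
Qed.


(** * Comparison of the two signs on one cell, and averaging over signs *)

Variables (n : nat) (kappa : R).
Hypothesis cell_le : forall k, U (cell @^-1` [set k]) <= kappa%:E.
Hypothesis n_le : (n%:R * (a ^+ 2 * kappa) <= 4^-1)%R.
Variable Fhat : n.-tuple (observation R d) -> covariate R d -> distfun R.
Hypothesis mFhat : is_predictor Fhat.

Let W s (D : n.-tuple (observation R d)) : R :=
  (\prod_(i < n) bump_density s (tnth D i))%R.

Let W_ge0 s D : (0 <= W s D)%R.
Proof. by apply: prodr_ge0 => i _; exact: bump_density_ge0. Qed.

Let mW s : measurable_fun [set: n.-tuple (observation R d)] (W s).
Proof. by apply: measurable_prod_tnth; exact: measurable_bump_density. Qed.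

Let Rn s k (D : n.-tuple (observation R d)) : R :=
  (\prod_(i < n) bump_affinity s k (tnth D i))%R.

Let integral_power_bump_law s (G : n.-tuple (observation R d) -> \bar R) :
  measurable_fun [set: _] G -> (forall D, 0 <= G D) ->
  \int[power_prob (bump_law s) n]_D G D =
  \int[power_prob M n]_D (G D * (W s D)%:E).
Proof.
move=> mG G0; exact: (power_prob_density (bump_density_ge0 s)
  (measurable_bump_density s) (@integral_bump_law s) mG G0).
Qed.

Let integral_W s : \int[power_prob M n]_D (W s D)%:E = 1.
Proof.
transitivity (\int[power_prob (bump_law s) n]_D 1).
  rewrite integral_power_bump_law//.
  by apply: eq_integral => D _; rewrite mul1e.
by rewrite integral_cst// mul1e; exact: probability_setT.
Qed.

(** With [u] the mass of the cell, the integral is (1 - a^2 u)^n >= 1 - n a^2 u, and [n_le] bounds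
    the loss by 1/4. *)
Let integral_Rn s k : (3 / 4)%:E <= \int[power_prob M n]_D (Rn s k D)%:E.
Proof.
pose A := cell @^-1` [set k]; pose u := fine (U A).
have mA : measurable A by exact: mcell.
have uE : U A = u%:E by rewrite fineK// fin_num_measure.
have u0 : (0 <= u)%R by rewrite fine_ge0// measure_ge0.
have u1 : (u <= 1)%R by rewrite -lee_fin -uE probability_le1.
have uk : (u <= kappa)%R by rewrite -lee_fin -uE cell_le.
rewrite (power_prob_prod (rho := (1 - a ^+ 2 * u)%R)); last 3 first.
- exact: bump_affinity_ge0.
- exact: measurable_bump_affinity.
- exact: integral_bump_affinity.
have /andP[a0 a1] := a01.
have au : (0 <= a ^+ 2 * u <= 1)%R.
  by rewrite mulr_ge0 ?sqr_ge0//= mulr_ile1 ?sqr_ge0 ?exprn_ile1.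
rewrite lee_fin; apply: le_trans (expr1B_ge n au).
have : (n%:R * (a ^+ 2 * u) <= n%:R * (a ^+ 2 * kappa))%R.
  by rewrite ler_wpM2l// ler_wpM2l// sqr_ge0.
by move=> /le_trans/(_ n_le); set t := (n%:R * _)%R => ?; lra.
Qed.

Let loss s x D := binary_L2 L (Fhat D x) (bump_regression s x).

Let mloss s : measurable_fun [set: n.-tuple (observation R d) * covariate R d]
  (fun p => loss s p.2 p.1).
Proof.
apply: (measurable_binary_L2 L (F := fun p => Fhat p.1 p.2)) => //.
exact: measurableT_comp (measurable_bump_regression s) measurable_snd.
Qed.

Let loss_ge0 s x D : 0 <= loss s x D.
Proof. exact: binary_L2_ge0. Qed.

Let H s x := \int[power_prob (bump_law s) n]_D loss s x D.

Let H_ge0 s x : 0 <= H s x.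
Proof. by apply: integral_ge0 => D _. Qed.

(** The two regression values at [x] are 2 a g(x) apart, so their separation contributes 4c with c =
    L (a g x)^2. The affinity keeps at least 3c of it, the penalty takes 2c since both likelihoods
    integrate to 1, and c remains. *)
Let le_H_flip s x :
  (L * (a * g x) ^+ 2)%:E <= H s x + H (flip s (cell x)) x.
Proof.
set s' := flip s (cell x); set c := (L * (a * g x) ^+ 2)%R.
have c0 : (0 <= c)%R by rewrite mulr_ge0 ?sqr_ge0// ltW.
have mlossx t : measurable_fun [set: n.-tuple (observation R d)] (loss t x).
  exact: (measurable_fun_pair1 x (mloss t)).
have mlW t : measurable_fun [set: n.-tuple (observation R d)]
    (fun D => loss t x D * (W t D)%:E).
  by apply: emeasurable_funM => //; exact/measurable_EFinP.
have lW0 t D : 0 <= loss t x D * (W t D)%:E by rewrite mule_ge0// lee_fin.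
have mWW : measurable_fun [set: n.-tuple (observation R d)]
    (fun D => (W s D)%:E + (W s' D)%:E).
  by apply: emeasurable_funD; exact/measurable_EFinP.
have WW0 D : 0 <= (W s D)%:E + (W s' D)%:E by rewrite adde_ge0// lee_fin.
have Rn0 t k D : (0 <= Rn t k D)%R.
  by apply: prodr_ge0 => i _; exact: bump_affinity_ge0.
have mRn t k : measurable_fun [set: n.-tuple (observation R d)]
    (fun D => (Rn t k D)%:E).
  apply/measurable_EFinP; apply: measurable_prod_tnth.
  exact: measurable_bump_affinity.
have le_pt D : (4 * c)%:E * (Rn s (cell x) D)%:E <=
    loss s x D * (W s D)%:E + loss s' x D * (W s' D)%:E +
    c%:E * ((W s D)%:E + (W s' D)%:E).
  (* The bound for one observation is multiplied over the sample; this is where the product form of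
     the minorant is used. *)
  have R2 : (Rn s (cell x) D ^+ 2 <= W s D * W s' D)%R.
    rewrite /Rn /W -big_split -prodrXl/=; apply: ler_prod => i _.
    by rewrite sqr_ge0 bump_affinity_sqr.
  have := binary_L2_weighted (Fhat D x) (bump_regression s x)
    (bump_regression s' x) L0 (W_ge0 s D) (W_ge0 s' D) (Rn0 s _ D) R2.
  have -> : ((bump_regression s x - bump_regression s' x) ^+ 2 =
      4 * (a * g x) ^+ 2)%R.
    rewrite /bump_regression /s' ffunE eqxx addTb.
    by case: (s _) => /=; ring.
  rewrite ![(W _ _)%:E * _]muleC; congr (_ <= _ + _).
    by rewrite -EFinM; congr EFin; rewrite /c; ring.
  by rewrite -EFinD -EFinM; congr EFin; rewrite /c; field.
have : \int[power_prob M n]_D ((4 * c)%:E * (Rn s (cell x) D)%:E) <=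
    H s x + H s' x + (2 * c)%:E.
  have -> : H s x + H s' x + (2 * c)%:E = \int[power_prob M n]_D
      (loss s x D * (W s D)%:E + loss s' x D * (W s' D)%:E +
       c%:E * ((W s D)%:E + (W s' D)%:E)).
    have m1 : measurable_fun [set: n.-tuple (observation R d)]
        (fun D => loss s x D * (W s D)%:E + loss s' x D * (W s' D)%:E).
      exact: emeasurable_funD (mlW s) (mlW s').
    have m2 : measurable_fun [set: n.-tuple (observation R d)]
        (fun D => c%:E * ((W s D)%:E + (W s' D)%:E)).
      exact: emeasurable_funM (measurable_cst _) mWW.
    rewrite ge0_integralD//; last 2 first.
    - by move=> D _; rewrite adde_ge0.
    - by move=> D _; rewrite mule_ge0.
    rewrite ge0_integralD//; congr (_ + _ + _).
    - exact: integral_power_bump_law.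
    - exact: integral_power_bump_law.
    rewrite ge0_integralZl// ge0_integralD//; last 4 first.
    - by move=> D _; rewrite lee_fin.
    - exact/measurable_EFinP.
    - by move=> D _; rewrite lee_fin.
    - exact/measurable_EFinP.
    by rewrite !integral_W -EFinD -EFinM mulrC.
  apply: ge0_le_integral => //.
  - by move=> D _; rewrite mule_ge0// lee_fin// mulr_ge0.
  - exact: emeasurable_funM.
  - apply: emeasurable_funD; first exact: emeasurable_funD (mlW s) (mlW s').
    exact: emeasurable_funM (measurable_cst _) mWW.
rewrite ge0_integralZl//; last 2 first.
- by move=> D _; rewrite lee_fin.
- by rewrite lee_fin mulr_ge0.
move=> le1; rewrite -(@leeD2rE _ (2 * c)%:E)//; apply: le_trans le1.
apply: (@le_trans _ _ ((4 * c)%:E * (3 / 4)%:E)).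
  by rewrite -EFinM -EFinD lee_fin; lra.
by apply: lee_wpmul2l => //; rewrite lee_fin mulr_ge0.
Qed.


(** A maximum is at least a mean: were every sign pattern below [c], so would be the average over
    all of them. At fixed x, pairing each pattern with its flip on the cell of x bounds this average
    below by half of the two-sign bound. *)
Lemma exists_bump_law_excess_risk_ge (c : R) :
  c%:E <= \int[U]_x (2^-1 * (L * (a * g x) ^+ 2))%:E ->
  exists s, c%:E <= excess_risk (bump_law s) Fhat
    (fun x => two_point_distfun L (bump_regression01 s x)).
Proof.
move=> c_le; pose A s := \int[U]_x H s x.
suff [s cA] : exists s, c%:E <= A s.
  exists s; apply: le_trans (excess_risk_two_point_law_ge L0
    (measurable_bump_regression s) (bump_regression01 s) mFhat).
  rewrite (le_trans cA)// le_eqVlt; apply/orP; left; apply/eqP; apply/esym.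
  exact: (fubini_tonelli _ (mloss s) (fun p => loss_ge0 s p.2 p.1)).
apply/not_existsP => Alt.
have {}Alt s : A s < c%:E by rewrite ltNge; apply/negP; exact: Alt.
have A0 s : 0 <= A s by apply: integral_ge0 => x _; exact: H_ge0.
(* The negated conclusion makes each mean loss finite, so the strict sum can be taken in the
   reals. *)
have AE s : A s = (fine (A s))%:E.
  by rewrite fineK// ge0_fin_numE// (lt_trans (Alt s))// ltry.
have mH s : measurable_fun [set: covariate R d] (H s).
  apply: (@measurable_fun_fubini_tonelli_G _ _ _ _ _
    (power_prob (bump_law s) n) _ (mloss s)).
  by move=> p; exact: loss_ge0.
pose N := #|{: {ffun I -> bool}}|.
have sum_lt : (\sum_(s : {ffun I -> bool}) fine (A s) < N%:R * c)%R.
  rewrite mulr_natl -sumr_const; apply: ltr_sum.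
    by apply/hasP; exists [ffun=> true] => //; rewrite mem_index_enum.
  by move=> s _; rewrite -lte_fin -AE.
have : (N%:R * c)%:E <= (\sum_(s : {ffun I -> bool}) fine (A s))%:E.
  rewrite -sumEFin; under eq_bigr do rewrite -AE.
  rewrite /A -ge0_integral_sum//.
  have h0 x : (0 <= 2^-1 * (L * (a * g x) ^+ 2))%R.
    by rewrite mulr_ge0// mulr_ge0 ?sqr_ge0// ltW.
  have mh : measurable_fun [set: covariate R d]
      (fun x => (2^-1 * (L * (a * g x) ^+ 2))%:E).
    apply/measurable_EFinP; apply: measurable_funM => //.
    apply: measurable_funM => //; apply: measurable_funX.
    exact: measurable_funM.
  rewrite EFinM; apply: (@le_trans _ _ (N%:R%:E *
      \int[U]_x (2^-1 * (L * (a * g x) ^+ 2))%:E)); first exact: lee_wpmul2l.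
  rewrite -ge0_integralZl//; last by move=> x _; rewrite lee_fin.
  apply: ge0_le_integral => //.
  - by move=> x _; rewrite mule_ge0// lee_fin.
  - exact: emeasurable_funM.
  - exact: emeasurable_sum.
  move=> x _; set h := (L * (a * g x) ^+ 2)%R.
  (* The flipped cell depends on [x], so the reindexing has to take place under the integral over
     [x]. *)
  have flip_sum : \sum_(s : {ffun I -> bool}) H (flip s (cell x)) x =
      \sum_(s : {ffun I -> bool}) H s x.
    rewrite [RHS](reindex (fun s => flip s (cell x)))//.
    by exists (flip^~ (cell x)) => s _; exact: flipK.
  have : (N%:R * h)%:E <= 2%:E * \sum_(s : {ffun I -> bool}) H s x.
    rewrite -[in leRHS](_ : 1 + 1 = 2%:E)// ge0_muleDl//.
    rewrite mul1e -[X in _ + X]flip_sum -big_split/=.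
    rewrite mulr_natl -sumr_const -sumEFin.
    by apply: lee_sum => s _; exact: le_H_flip.
  move=> /(lee_wpmul2l (x := (2^-1)%:E)).
  rewrite muleA -!EFinM mulVf// mul1e lee_fin invr_ge0 => /(_ (ler0n _ 2)).
  by rewrite mulrCA.
by rewrite lee_fin leNgt sum_lt.
Qed.

End assouad.

(** * The grid of bumps *)

Section tent.
Context {R : realType}.
Implicit Types t u v : R.

(** Distance from [u] to the nearest integer. *)
Definition tent u : R :=
  Num.min (u - (Num.floor u)%:~R) ((Num.floor u + 1)%:~R - u).

Lemma tent_ge0 u : 0 <= tent u.
Proof.
have /andP[f1 f2] := floor_itv u.
by rewrite /tent le_min !subr_ge0 f1 ltW.
Qed.

Lemma measurable_tent : measurable_fun [set: R] tent.
Proof.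
have mf : measurable_fun [set: R] (fun u => (Num.floor u)%:~R : R).
  by apply: nondecreasing_measurable => // u v uv; rewrite ler_int le_floor.
apply: measurable_minr; apply: measurable_funB => //.
under eq_fun do rewrite intrD; exact: measurable_funD.
Qed.

Lemma tent_dist u v : Num.floor u = Num.floor v ->
  `|tent u - tent v| <= `|u - v|.
Proof.
move=> uv; rewrite /tent uv.
set f := (Num.floor v)%:~R; set f1 := (_ + 1)%:~R.
have := ler_norm (u - v); have := ler_norm (v - u); rewrite [`|v - u|]distrC.
set D := `|u - v| => d1 d2.
rewrite ler_norml !minEle; case: (leP (u - f)) => h1; case: (leP (v - f)) => h2;
  apply/andP; split; lra.
Qed.

(** An integer lies between [u] and [v], and each tent value is at most the distance to it. This
    controls a change of sign across a cell boundary, where two bumps add up. *)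
Lemma tentD u v : Num.floor u != Num.floor v -> tent u + tent v <= `|u - v|.
Proof.
wlog uv : u v / Num.floor u < Num.floor v.
  move=> W; rewrite neq_lt => /orP[lt|lt]; first by apply: W; rewrite ?lt_eqF.
  by rewrite addrC distrC; apply: W; rewrite ?lt_eqF.
move=> _; have fv : (Num.floor u + 1)%:~R <= v.
  by apply: (le_trans _ (floor_le v)); rewrite ler_int lezD1.
have := ler_norm (v - u); rewrite distrC.
have fuv : ((Num.floor u + 1)%:~R : R) <= (Num.floor v)%:~R.
  by rewrite ler_int lezD1.
have t1 : tent u <= (Num.floor u + 1)%:~R - u by rewrite /tent ge_min lexx orbT.
have t2 : tent v <= v - (Num.floor v)%:~R by rewrite /tent ge_min lexx.
move: fv fuv t1 t2; set D := `|_|; set F := (_ + 1)%:~R.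
set f := (Num.floor v)%:~R; set tu := tent u; set tv := tent v.
by move=> *; lra.
Qed.

End tent.

Lemma uniform_prob01_itvcc (R : realType) (u v : R) : 0 <= u -> u <= v -> v <= 1 ->
  uniform_prob (@ltr01 R) `[u, v] = (v - u)%:E.
Proof.
move=> u0 uv v1; rewrite uniform_prob01E; last exact: measurable_itv.
have -> : `[u, v]%classic `&` `[(0 : R), 1]%classic = `[u, v]%classic.
  apply/setIidPl => x /=; rewrite !in_itv/= => /andP[ux xv].
  by rewrite (le_trans u0 ux) (le_trans xv v1).
rewrite lebesgue_measure_itv/= lte_fin; case: ltP => // vu.
by congr EFin; lra.
Qed.

Lemma ler_norm_minB (R : realDomainType) (x y x' y' D : R) :
  `|x - x'| <= D -> `|y - y'| <= D -> `|Num.min x y - Num.min x' y'| <= D.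
Proof.
rewrite !ler_norml !minEle => /andP[? ?] /andP[? ?].
by case: (leP x y) => ?; case: (leP x' y') => ?; apply/andP; split; lra.
Qed.

(** * Cells, bumps and their Hoelder bound *)

Section grid.
Context {R : realType} {d : nat}.
Variable m : nat.
Hypothesis m_gt0 : (0 < m)%N.
Local Notation point := (covariate R d).

Let m0 : 0 < m%:R :> R. Proof. by rewrite ltr0n. Qed.

(** The index [m] receives the endpoint t = 1. Points outside [[0, 1]] also get an index, but carry
    no mass. *)
Definition grid_index (t : R) : 'I_m.+1 := inord (Num.truncn (m%:R * t)).

Definition grid_cell (x : point) : {ffun 'I_d -> 'I_m.+1} :=
  [ffun i => grid_index (tnth x i)].

(** Sup-norm distance to the boundary of the cell of the unbounded grid, in units of its side. The
    initial value [2^-1] is the largest value of [tent]. *)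
Definition grid_bump (x : point) : R :=
  \big[Num.min/2^-1]_(i < d) tent (m%:R * (tnth x i : R)).

Lemma grid_bump_ge0 x : 0 <= grid_bump x.
Proof.
apply: (big_ind (fun u => 0 <= u)) => // [u v u0 v0|i _]; last exact: tent_ge0.
by rewrite le_min u0.
Qed.

Lemma grid_bump_le x : grid_bump x <= 2^-1.
Proof. exact: bigmin_le_id. Qed.

Lemma grid_bump_le_tent x i : grid_bump x <= tent (m%:R * (tnth x i : R)).
Proof. exact: bigmin_le. Qed.

Let measurable_coord i : measurable_fun [set: point] (fun x => tnth x i : R).
Proof. exact: measurable_tnth. Qed.

Lemma measurable_grid_bump : measurable_fun [set: point] grid_bump.
Proof.
rewrite /grid_bump; elim: (index_enum _) => [|i s IH].
  by under eq_fun do rewrite big_nil; exact: measurable_cst.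
under eq_fun do rewrite big_cons.
apply: (measurable_minr (f := fun x : point => tent (m%:R * (tnth x i : R)))) => //.
apply: (measurableT_comp measurable_tent).
by apply: measurable_funM => //; exact: measurable_coord.
Qed.

Lemma measurable_grid_index j : measurable (grid_index @^-1` [set j]).
Proof.
have mt : measurable_fun [set: R] (fun t => (Num.truncn (m%:R * t))%:R : R).
  apply: nondecreasing_measurable => // u v uv; rewrite ler_nat le_truncn//.
  by rewrite ler_wpM2l// ltW.
(* [inord] sends out-of-range values to 0 and so is not monotone; hence the passage through level
   sets of the monotone truncation. *)
rewrite (_ : _ @^-1` _ = \bigcup_(k in [set k | inord k = j])
    ((fun t => (Num.truncn (m%:R * t))%:R : R) @^-1` [set k%:R])).
  apply: bigcup_measurable => k _; rewrite -[X in measurable X]setTI.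
  by apply: mt.
apply/seteqP; split => [t /= tj|t [k /= <-] /eqP].
  by exists (Num.truncn (m%:R * t)).
by rewrite eqr_nat => /eqP <-.
Qed.

Let grid_cell_preimage k : grid_cell @^-1` [set k] =
  [set x : point | forall i, (grid_index @^-1` [set k i]) (tnth x i)].
Proof.
apply/seteqP; split => x /= => [<- i|xk]; first by rewrite ffunE.
by apply/ffunP => i; rewrite ffunE.
Qed.

Lemma measurable_grid_cell k : measurable (grid_cell @^-1` [set k]).
Proof.
rewrite grid_cell_preimage (_ : mkset _ = \bigcap_(i in [set: 'I_d])
   ((fun x : point => tnth x i) @^-1` (grid_index @^-1` [set k i]))); last first.
  by apply/seteqP; split => [x h i _|x h i]; exact: h.
apply: fin_bigcap_measurable => // i _; rewrite -[X in measurable X]setTI.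
by apply: measurable_tnth => //; exact: measurable_grid_index.
Qed.

(** Within [[0, 1]] the preimage lies in the closed interval from j/m to (j+1)/m. It is smaller for
    j = m, where only t = 1 is left, hence an inequality. *)
Lemma uniform_grid_index j :
  (uniform_prob (@ltr01 R) (grid_index @^-1` [set j]) <= (m%:R^-1)%:E)%E.
Proof.
rewrite uniform_prob01E; last exact: measurable_grid_index.
have -> : (m%:R^-1)%:E =
    lebesgue_measure `[(j%:R / m%:R : R), (j.+1%:R / m%:R)].
  rewrite lebesgue_measure_itv/= lte_fin ltr_pM2r ?invr_gt0// ltr_nat ltnSn.
  by rewrite -EFinD -mulrBl -natrB// subSnn mul1r.
apply: le_measure; rewrite ?inE.
- by apply: measurableI => //; exact: measurable_grid_index.
- exact: measurable_itv.
move=> t [/= tj]; rewrite !in_itv/= => /andP[t0 t1].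
have mt0 : 0 <= m%:R * t by rewrite mulr_ge0// ltW.
have tm : (Num.truncn (m%:R * t) < m.+1)%N.
  rewrite -(ltr_nat R) (@le_lt_trans _ _ (m%:R * t))// ?truncn_le//.
  by rewrite (@le_lt_trans _ _ m%:R) ?ltr_nat// ler_piMr// ltW.
have := truncn_itv mt0; move: tj; rewrite /grid_index => /(congr1 val)/=.
rewrite inordK// => -> /andP[h1 h2].
by rewrite ler_pdivrMr// mulrC h1 ler_pdivlMr// mulrC ltW.
Qed.

Lemma uniform_grid_cell k :
  (uniform_cube R d (grid_cell @^-1` [set k]) <= (m%:R ^- d)%:E)%E.
Proof.
have -> : (uniform_cube R d (grid_cell @^-1` [set k]) = \prod_(i < d)
    uniform_prob (@ltr01 R) (grid_index @^-1` [set k i]))%E.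
  rewrite grid_cell_preimage; apply: power_prob_rect => i.
  exact: measurable_grid_index.
pose p i := fine (uniform_prob (@ltr01 R) (grid_index @^-1` [set k i])).
have pE i : uniform_prob (@ltr01 R) (grid_index @^-1` [set k i]) = (p i)%:E.
  by rewrite fineK// fin_num_measure//; exact: measurable_grid_index.
rewrite (eq_bigr (fun i => (p i)%:E)) => [|i _]; last exact: pE.
rewrite prodEFin lee_fin -exprVn -[X in _ ^+ X](card_ord d) -prodr_const.
apply: ler_prod => i _; rewrite fine_ge0 ?measure_ge0//=.
by rewrite -lee_fin -pE uniform_grid_index.
Qed.


Let core : set R := [set t | 4^-1 <= tent (m%:R * t)].

Let measurable_core : measurable core.
Proof.
have mt : measurable_fun [set: R] (fun t => tent (m%:R * t)).
  by apply: (measurableT_comp measurable_tent); exact: measurable_funM.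
rewrite (_ : core = (fun t => tent (m%:R * t)) @^-1` `[4^-1, +oo[).
  by rewrite -[X in measurable X]setTI; exact: mt.
by apply/seteqP; split => t /=; rewrite in_itv/= andbT.
Qed.

(** The set contains the middle half of each of the m intervals of length 1/m; these halves are
    disjoint and have total length 1/2. *)
Let uniform_core : ((2^-1)%:E <= uniform_prob (@ltr01 R) core)%E.
Proof.
pose l (j : 'I_m) : R := (j%:R + 4^-1) / m%:R.
pose r (j : 'I_m) : R := (j%:R + 3 / 4) / m%:R.
pose A j : set (measurableTypeR R) := `[l j, r j]%classic.
have Ain j t : A j t -> j%:R + 4^-1 <= m%:R * t <= j%:R + 3 / 4.
  by rewrite /A/= in_itv/= ler_pdivrMr// ler_pdivlMr// ![t * _]mulrC.
have AE j : uniform_prob (@ltr01 R) (A j) = (2^-1 / m%:R)%:E.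
  have jm : j%:R + 1 <= m%:R :> R by rewrite natr1 ler_nat.
  have j0 : 0 <= j%:R :> R by [].
  rewrite uniform_prob01_itvcc.
  - by congr EFin; rewrite -mulrBl; congr (_ / _); lra.
  - by rewrite divr_ge0 ?addr_ge0// ltW.
  - by rewrite ler_pM2r ?invr_gt0//; lra.
  - by rewrite ler_pdivrMr//; lra.
have tA : trivIset [set: 'I_m] A.
  move=> i j _ _ [t [/Ain/andP[i1 i2] /Ain/andP[j1 j2]]].
  apply/val_inj/eqP; rewrite eqn_leq.
  by apply/andP; split; rewrite -ltnS -(ltr_nat R) -natr1; lra.
have -> : (2^-1)%:E = uniform_prob (@ltr01 R) (\big[setU/set0]_(j < m) A j).
  rewrite measure_bigsetU_ord//; last by move=> j; exact: measurable_itv.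
  rewrite (eq_bigr (fun=> (2^-1 / m%:R)%:E)) => [|j _]; last exact: AE.
  rewrite sumEFin sumr_const card_ord -[_ *+ m]mulr_natr mulfVK//.
  by rewrite gt_eqF.
apply: le_measure; rewrite ?inE//.
  by apply: bigsetU_measurable => j _; exact: measurable_itv.
apply: (big_ind (fun S => S `<=` core)) => [t []|S S' SA S'A t []|j _ t].
- exact: SA.
- exact: S'A.
move=> /Ain/andP[t1 t2].
have ft : Num.floor (m%:R * t) = Posz j.
  by apply: floor_def; rewrite intrD -[(Posz j)%:~R]/(j%:R); apply/andP; split; lra.
rewrite /core/= /tent ft le_min intrD -[(Posz j)%:~R]/(j%:R).
by apply/andP; split; lra.
Qed.

Lemma uniform_grid_bump_ge :
  ((2^-1 ^+ d)%:E <= uniform_cube R d [set x | (4^-1 <= grid_bump x)%R])%E.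
Proof.
pose S := [set x : point | forall i, core (tnth x i)].
have mS : measurable S.
  rewrite (_ : S = \bigcap_(i in [set: 'I_d])
      ((fun x : point => tnth x i) @^-1` core)); last first.
    by apply/seteqP; split => [x h i _|x h i]; exact: h.
  apply: fin_bigcap_measurable => // i _; rewrite -[X in measurable X]setTI.
  by apply: measurable_tnth.
apply: (@le_trans _ _ (uniform_cube R d S)).
  have -> : (uniform_cube R d S = \prod_(i < d)
      uniform_prob (@ltr01 R) core)%E by exact: power_prob_rect.
  pose p := fine (uniform_prob (@ltr01 R) core).
  have pE : uniform_prob (@ltr01 R) core = p%:E by rewrite fineK// fin_num_measure.
  rewrite (eq_bigr (fun=> p%:E)) => [|i _]; last exact: pE.
  rewrite prodEFin lee_fin prodr_const card_ord lerXn2r ?nnegrE ?invr_ge0//.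
    by rewrite fine_ge0// measure_ge0.
  by rewrite -lee_fin -pE.
apply: le_measure; rewrite ?inE//.
  have := measurable_grid_bump measurableT (measurable_itv `[4^-1, +oo[).
  rewrite setTI; congr (measurable _); apply/seteqP.
  by split => x /=; rewrite in_itv/= andbT.
move=> x Sx /=; apply: (big_ind (fun u => 4^-1 <= u)) => //.
- by lra.
- by move=> u v u4 v4; rewrite le_min u4.
- by move=> i _; exact: Sx.
Qed.

Lemma coord_dist_le (x x' : point) i :
  `|(tnth x i : R) - tnth x' i| <= euclid_dist x x'.
Proof.
rewrite /euclid_dist -sqrtr_sqr ler_wsqrtr// (bigD1 i)//= lerDl.
by apply: sumr_ge0 => j _; exact: sqr_ge0.
Qed.

(** A bound that is at once Lipschitz at scale 1/m and uniform, from which every Hoelder exponent in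
    (0, 1] is obtained by interpolation. Within a cell the sign is common and the bump is a minimum
    of Lipschitz functions. *)
Lemma bump_regression_grid_dist (a : R) s (x x' : point) : 0 <= a ->
  `|bump_regression a grid_cell grid_bump s x' -
    bump_regression a grid_cell grid_bump s x| <=
  a * Num.min 1 (m%:R * euclid_dist x' x).
Proof.
move=> a0; have g0 := grid_bump_ge0; have g1 := grid_bump_le.
have mdist i : `|m%:R * (tnth x' i : R) - m%:R * (tnth x i : R)| <=
    m%:R * euclid_dist x' x.
  by rewrite -mulrBr normrM gtr0_norm// ler_pM2l//; exact: coord_dist_le.
have [allfl|] := boolP [forall i, Num.floor (m%:R * (tnth x' i : R)) ==
    Num.floor (m%:R * (tnth x i : R))].
  have fl i : Num.floor (m%:R * (tnth x' i : R)) =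
      Num.floor (m%:R * (tnth x i : R)) by exact/eqP/(forallP allfl).
  have -> : bump_regression a grid_cell grid_bump s x' -
      bump_regression a grid_cell grid_bump s x =
      (if s (grid_cell x) then a else - a) * (grid_bump x' - grid_bump x).
    rewrite /bump_regression (_ : grid_cell x' = grid_cell x).
      by case: ifP => _; ring.
    by apply/ffunP => i; rewrite !ffunE /grid_index !truncEfloor fl.
  rewrite normrM (_ : `|if _ then _ else _| = a); last first.
    by case: ifP => _; rewrite ?normrN ger0_norm.
  rewrite ler_wpM2l// le_min; apply/andP; split.
    have := g0 x; have := g0 x'; have := g1 x; have := g1 x'.
    by rewrite ler_norml => *; apply/andP; split; lra.
  rewrite /grid_bump.
  apply: (big_ind2 (fun u v => `|u - v| <= m%:R * euclid_dist x' x)).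
  - by rewrite subrr normr0 mulr_ge0 ?sqrtr_ge0// ltW.
  - by move=> u v u' v' h1 h2; exact: ler_norm_minB.
  - by move=> i _; apply: le_trans (mdist i); exact: tent_dist.
(* The signs at [x] and [x'] may now differ, so the difference is bounded by the sum of the two
   bumps, and this sum by the tents in the coordinate [i] that separates the points. *)
rewrite negb_forall => /existsP[i fl].
apply: (@le_trans _ _ (a * (grid_bump x' + grid_bump x))).
  have ag y : 0 <= a * grid_bump y by rewrite mulr_ge0.
  have := ag x; have := ag x'; rewrite mulrDr /bump_regression.
  by case: ifP => _; case: ifP => _; rewrite ler_norml => *; apply/andP; split; lra.
rewrite ler_wpM2l// le_min; apply/andP; split.
  by have := g1 x; have := g1 x'; lra.
apply: le_trans (mdist i); apply: le_trans (tentD fl).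
by apply: lerD; exact: grid_bump_le_tent.
Qed.

End grid.

(** For h between 0 and 1, t^h lies between 1 and t. *)
Lemma min1_le_powR (R : realType) (t h : R) : 0 < h -> h <= 1 -> 0 <= t ->
  Num.min 1 t <= t `^ h.
Proof.
move=> h0 h1 t0; case: (leP 1 t) => t1.
  by rewrite -[X in X <= _](powRr0 t)// ler_powR// ltW.
have [->|tn0] := eqVneq t 0; first by rewrite powR_ge0.
by rewrite ger1_powR// lt_neqAle eq_sym tn0 t0 ltW.
Qed.

(** * Rates *)

(** The inequality with [C] places the laws in the class, and the one with [n] keeps opposite signs
    hard to distinguish. In the bound, [2^-1] comes from pairing signs, and the bump is at least
    [4^-1] on a set of mass at least [2^-1 ^+ d]. *)
Lemma minimax_two_point_bound (R : realType) (d : nat) (h C L a : R) (m n : nat) :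
  0 < h -> h <= 1 -> 0 < L -> (0 < m)%N -> 0 <= a <= 1 ->
  a * Num.sqrt L * m%:R `^ h <= C ->
  n%:R * (a ^+ 2 * m%:R ^- d) <= 4^-1 ->
  forall Fhat : n.-tuple (observation R d) -> covariate R d -> distfun R,
  is_predictor Fhat ->
  exists P Fstar, [/\ class_B h C L P, is_cond_cdf P Fstar &
    ((2^-1 * (L * (a * 4^-1) ^+ 2) * 2^-1 ^+ d)%:E <=
     excess_risk P Fhat Fstar)%E].
Proof.
move=> h0 h1 L0 m0 a01 aC na Fhat mFhat; have /andP[a0 a1] := a01.
have g01 x : 0 <= grid_bump (R := R) (d := d) m x <= 2^-1.
  by rewrite grid_bump_ge0// grid_bump_le.
have mcell := @measurable_grid_cell R d m.
have mg := @measurable_grid_bump R d m.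
pose c := 2^-1 * (L * (a * 4^-1) ^+ 2).
have c0 : 0 <= c by rewrite mulr_ge0// mulr_ge0 ?sqr_ge0// ltW.
have [s sP] : exists s : {ffun {ffun 'I_d -> 'I_m.+1} -> bool},
    ((c * 2^-1 ^+ d)%:E <= excess_risk (bump_law L a mcell mg s) Fhat
      (fun x => two_point_distfun L (bump_regression01 (grid_cell m) a01 g01 s x)))%E.
  apply: (exists_bump_law_excess_risk_ge L0 a01 mcell mg g01
    (uniform_grid_cell m0) na mFhat).
  pose S := [set x | (4^-1 <= grid_bump (R := R) (d := d) m x)%R].
  have mS : measurable S.
    have := mg measurableT _ (measurable_itv `[4^-1, +oo[).
    rewrite setTI; congr (measurable _); apply/seteqP.
    by split => x /=; rewrite in_itv/= andbT.
  apply: (@le_trans _ _ (\int[uniform_cube R d]_x (c%:E * (\1_S x)%:E))%E).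
    rewrite ge0_integralZl ?lee_fin//; last first.
      by apply/measurable_EFinP; exact: measurable_indic.
    rewrite integral_indic// setIT EFinM.
    by apply: lee_wpmul2l; [rewrite lee_fin|exact: uniform_grid_bump_ge].
  apply: ge0_le_integral => //.
  - by move=> x _; rewrite mule_ge0// lee_fin.
  - by apply: emeasurable_funM => //; apply/measurable_EFinP; exact: measurable_indic.
  - apply/measurable_EFinP; apply: measurable_funM => //.
    by apply: measurable_funM => //; apply: measurable_funX; exact: measurable_funM.
  move=> x _; rewrite -EFinM lee_fin indicE; have /andP[g0 _] := g01 x.
  case: (boolP (x \in S)) => [|_]; last first.
    by rewrite mulr0 mulr_ge0// mulr_ge0 ?sqr_ge0// ltW.
  rewrite inE /S/= => g4; rewrite mulr1 /c; apply: ler_wpM2l => //.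
  apply: ler_wpM2l (ltW L0) _ _ _.
  by rewrite ler_sqr ?nnegrE ?mulr_ge0// ler_wpM2l.
exists (bump_law L a mcell mg s),
  (fun x => two_point_distfun L (bump_regression01 (grid_cell m) a01 g01 s x)).
split => //.
- apply: two_point_law_class_B => // [x|x x' _ _].
    exact: bump_regression01.
  have r0 : 0 <= euclid_dist x' x by exact: sqrtr_ge0.
  have L0' : 0 <= Num.sqrt L by exact: sqrtr_ge0.
  apply: (@le_trans _ _ (a * Num.min 1 (m%:R * euclid_dist x' x) * Num.sqrt L)).
    by rewrite ler_wpM2r//; exact: bump_regression_grid_dist.
  apply: (@le_trans _ _ (a * Num.sqrt L * m%:R `^ h * euclid_dist x' x `^ h)).
    rewrite -[leRHS]mulrA -powRM// [leLHS]mulrAC ler_wpM2l ?mulr_ge0//.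
    by apply: min1_le_powR => //; rewrite mulr_ge0.
  by rewrite ler_wpM2r// powR_ge0.
- exact: two_point_law_cond_cdf.
Qed.

(** With b = 2h + d and B = 4 n C^2 / L, saturating the Hoelder condition gives n a^2 m^-d = (B / 4)
    / m^b, so m must be at least B^(1/b). The second condition on B is what a <= 1 requires of this
    m. *)
Lemma grid_size_exists (R : realType) (d : nat) (h L C : R) (n : nat) :
  0 < h -> 0 < L -> 0 < C ->
  1 <= 4 * n%:R * C ^+ 2 / L ->
  (C ^+ 2 / L) `^ ((2 * h + d%:R) / (2 * h)) <= 4 * n%:R * C ^+ 2 / L ->
  exists m : nat, exists a : R, [/\ (0 < m)%N, 0 <= a <= 1,
    a * Num.sqrt L * m%:R `^ h <= C,
    n%:R * (a ^+ 2 * m%:R ^- d) <= 4^-1 &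
    C ^+ 2 / (2 * (4 * n%:R * C ^+ 2 / L) `^ (2 * h + d%:R)^-1) `^ (2 * h)
      <= L * a ^+ 2].
Proof.
move=> h0 L0 C0; set b := 2 * h + d%:R; set B := 4 * n%:R * C ^+ 2 / L => B1 BC.
have d0 : 0 <= d%:R :> R by [].
have b0 : 0 < b by rewrite ltr_pwDl// mulr_gt0.
have h2 : 0 < 2 * h by rewrite mulr_gt0.
have B0 : 0 < B by apply: lt_le_trans B1.
pose t := B `^ b^-1.
have t1 : 1 <= t by rewrite -(powRr0 B) ler_powR// invr_ge0 ltW.
have t0 : 0 < t by apply: lt_le_trans t1.
have tb : t `^ b = B by rewrite /t -powRrM mulVf ?gt_eqF// powRr1// ltW.
(* Rounding up yields t <= m <= 2t, the latter because t >= 1: the first inequality serves the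
   constraints, the second the rate. *)
pose m := (Num.truncn t).+1; pose M : R := m%:R.
have M0 : 0 < M by rewrite ltr0n.
have tM : t <= M by rewrite ltW// truncnS_gt.
have M2t : M <= 2 * t.
  have : (Num.truncn t)%:R <= t by rewrite truncn_le ltW.
  by rewrite /M /m -natr1; lra.
have sL : 0 < Num.sqrt L by rewrite sqrtr_gt0.
have Mh0 : 0 < M `^ h by rewrite powR_gt0.
have M2h0 : 0 < M `^ (2 * h) by rewrite powR_gt0.
have M2hE : (M `^ h) ^+ 2 = M `^ (2 * h).
  by rewrite -powR_mulrn ?powR_ge0// -powRrM mulrC.
pose a := C / (Num.sqrt L * M `^ h).
have a2E : a ^+ 2 = C ^+ 2 / (L * M `^ (2 * h)).
  by rewrite /a expr_div_n exprMn sqr_sqrtr ?(ltW L0)// M2hE.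
have a0 : 0 <= a by rewrite divr_ge0 ?mulr_ge0 ?ltW.
exists m, a; split=> //.
- rewrite a0/= -(@ler_pXn2r _ 2)// ?nnegrE// expr1n a2E.
  rewrite ler_pdivrMr ?mulr_gt0// mul1r mulrC -ler_pdivrMr//.
  apply: (@le_trans _ _ (t `^ (2 * h))); last first.
    by apply: ge0_ler_powR => //; rewrite ?nnegrE ltW.
  have -> : C ^+ 2 / L = ((C ^+ 2 / L) `^ (b / (2 * h))) `^ (2 * h / b).
    rewrite -powRrM (_ : b / _ * _ = 1); last by field; rewrite !gt_eqF.
    by rewrite powRr1// divr_ge0 ?sqr_ge0// ltW.
  rewrite /t -[leRHS]powRrM [b^-1 * _]mulrC.
  apply: ge0_ler_powR => //; rewrite ?nnegrE ?powR_ge0 ?(ltW B0)//.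
  by rewrite divr_ge0// ltW.
- rewrite /a le_eqVlt; apply/orP; left; apply/eqP; rewrite -/M.
  by field; rewrite !gt_eqF.
- rewrite a2E -/M.
  have -> : n%:R * (C ^+ 2 / (L * M `^ (2 * h)) * M ^- d) =
      B / 4 / M `^ b.
    rewrite /b powRD; last by rewrite (gt_eqF M0) implybT.
    rewrite powR_mulrn ?(ltW M0)// /B.
    by field; rewrite !gt_eqF ?exprn_gt0.
  rewrite ler_pdivrMr ?powR_gt0// -tb mulrC ler_pM2l//.
  by apply: ge0_ler_powR => //; rewrite ?nnegrE ltW.
- have -> : L * a ^+ 2 = C ^+ 2 / M `^ (2 * h).
    by rewrite a2E; field; rewrite !gt_eqF.
  rewrite ler_pM2l ?exprn_gt0// lef_pV2 ?posrE ?powR_gt0 ?mulr_gt0//.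
  by apply: ge0_ler_powR => //; rewrite ?nnegrE ltW// mulr_gt0.
Qed.

Lemma rate_expr (R : realType) (d : nat) (h L C : R) (n : nat) :
  0 < h -> 0 < L -> 0 < C -> (0 < n)%N ->
  let b := 2 * h + d%:R in
  C ^+ 2 / (2 * (4 * n%:R * C ^+ 2 / L) `^ b^-1) `^ (2 * h) =
  (2 `^ (2 * h) * (4 / L) `^ (2 * h / b))^-1 *
    (C `^ (2 * d%:R / b) * n%:R `^ (- (2 * h / b))).
Proof.
move=> h0 L0 C0 n0 b.
have d0 : 0 <= d%:R :> R by [].
have b0 : 0 < b by rewrite ltr_pwDl// mulr_gt0.
have n0' : 0 < n%:R :> R by rewrite ltr0n.
have B0 : 0 < 4 * n%:R * C ^+ 2 / L by rewrite divr_gt0 ?mulr_gt0 ?exprn_gt0.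
set p := 2 * h / b.
rewrite powRM ?powR_ge0// -powRrM mulrC -[b^-1 * _]mulrC.
rewrite -/p.
have -> : 4 * n%:R * C ^+ 2 / L = 4 / L * (C ^+ 2 * n%:R).
  by field; rewrite gt_eqF.
rewrite powRM ?divr_ge0 ?mulr_ge0 ?sqr_ge0 ?ltW// powRM ?sqr_ge0//.
rewrite powRN.
(* The exponents satisfy 2d/b + 2 (2h/b) = 2: this splits off the power of [C] in the rate and
   cancels the one coming from the grid size. *)
have C2 : C ^+ 2 = C `^ (2 * d%:R / b) * (C ^+ 2) `^ p.
  rewrite -{2}(powR_mulrn 2 (ltW C0)) -powRrM -powRD; last first.
    by rewrite (gt_eqF C0) implybT.
  rewrite (_ : _ + _ = 2%:R); last by rewrite /p /b; field; rewrite gt_eqF.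
  by rewrite powR_mulrn// ltW.
rewrite [X in _ * X = _]C2.
by field; rewrite !gt_eqF ?powR_gt0 ?exprn_gt0// divr_gt0.
Qed.

(** [K] is chosen before [C]: it is the constant of [rate_expr] times the numerical factor [q]. Only
    the threshold on [n] depends on [C]. *)
Lemma minimax_rate_bound (R : realType) (d : nat) (h L : R) :
  0 < h -> h <= 1 -> 0 < L ->
  exists2 K : R, 0 < K & forall C : R, 0 < C ->
  exists N : nat, forall n, (N <= n)%N ->
  forall Fhat : n.-tuple (observation R d) -> covariate R d -> distfun R,
  is_predictor Fhat ->
  exists P Fstar, [/\ class_B h C L P, is_cond_cdf P Fstar &
    ((K * (C `^ (2 * d%:R / (2 * h + d%:R)) *
           n%:R `^ (- (2 * h / (2 * h + d%:R)))))%:E <=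
     excess_risk P Fhat Fstar)%E].
Proof.
move=> h0 h1 L0; set b := 2 * h + d%:R.
pose K0 : R := (2 `^ (2 * h) * (4 / L) `^ (2 * h / b))^-1.
have K00 : 0 < K0 by rewrite invr_gt0 mulr_gt0 ?powR_gt0// divr_gt0.
pose q : R := 2^-1 * 4^-1 ^+ 2 * 2^-1 ^+ d.
have q0 : 0 < q by rewrite !mulr_gt0 ?exprn_gt0 ?invr_gt0.
exists (q * K0) => [|C C0]; first by rewrite mulr_gt0.
(* Both conditions of [grid_size_exists] read E <= 4 n C^2 / L, which determines the threshold. *)
pose E := Num.max 1 ((C ^+ 2 / L) `^ (b / (2 * h))).
exists (Num.truncn (E / (4 * C ^+ 2 / L))).+1 => n Nn Fhat mFhat.
have n0 : (0 < n)%N by apply: leq_trans Nn.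
have w0 : 0 < 4 * C ^+ 2 / L by rewrite divr_gt0// mulr_gt0// exprn_gt0.
have EB : E <= 4 * n%:R * C ^+ 2 / L.
  rewrite (_ : 4 * _ * _ / _ = n%:R * (4 * C ^+ 2 / L)); last first.
    by field; rewrite gt_eqF.
  rewrite -ler_pdivrMr// (le_trans (ltW (truncnS_gt _)))// ler_nat.
  exact: Nn.
have [B1 B2] : 1 <= 4 * n%:R * C ^+ 2 / L /\
    (C ^+ 2 / L) `^ (b / (2 * h)) <= 4 * n%:R * C ^+ 2 / L.
  by split; apply: le_trans EB; rewrite le_max lexx ?orbT.
have [m [a [m0 a01 aC na aLe]]] := grid_size_exists h0 L0 C0 B1 B2.
have [P [Fstar [PB PF PE]]] := minimax_two_point_bound h0 h1 L0 m0 a01 aC na mFhat.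
exists P, Fstar; split => //; apply: le_trans PE; rewrite lee_fin.
rewrite -mulrA -rate_expr//.
rewrite (_ : 2^-1 * _ * _ = q * (L * a ^+ 2)); last by rewrite /q; ring.
by rewrite ler_pM2l.
Qed.

(** * Passage to the minimax ratio and its lower limit *)

Lemma limn_einf_ge (R : realType) (u : (\bar R)^nat) (l : \bar R) N :
  (forall n, (N <= n)%N -> (l <= u n)%E) -> (l <= limn_einf u)%E.
Proof.
move=> lu; rewrite limn_einf_lim; apply: lime_ge; first exact: is_cvg_einfs.
exists N => // n /= Nn; apply: le_ereal_inf_tmp => _ [k /= nk <-].
exact/lu/(leq_trans Nn).
Qed.

Lemma minimax_ratio_ge (R : realType) (d : nat) (h C L A c : R) (n : nat) :
  0 < A ->
  (forall Fhat : n.-tuple (observation R d) -> covariate R d -> distfun R,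
    is_predictor Fhat ->
    exists P Fstar, [/\ class_B h C L P, is_cond_cdf P Fstar &
      ((c * A)%:E <= excess_risk P Fhat Fstar)%E]) ->
  (c%:E <= minimax_ratio d h C L A n)%E.
Proof.
move=> A0 cA; apply: le_ereal_inf_tmp => _ [Fhat mFhat <-].
have [P [Fstar [PB PF PE]]] := cA Fhat mFhat.
apply: (@le_trans _ _ (excess_risk P Fhat Fstar / A%:E)%E).
  by rewrite inver gt_eqF// lee_pdivlMr// -EFinM.
by apply: ereal_sup_ubound; exists P, Fstar.
Qed.

Theorem proposition3 (R : realType) (d : nat) (h L : R)
    (d_ge1 : (1 <= d)%N) (h_gt0 : 0 < h) (h_le1 : h <= 1) (L_gt0 : 0 < L) :
  (forall C : R, 0 < C ->
    (0 < limn_einf (fun n : nat =>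
       minimax_ratio d h C L
         (n%:R `^ (- (2 * h / (2 * h + d%:R)))) n))%E) /\
  (exists2 C1 : R, 0 < C1 &
    forall C : R, 0 < C ->
      (C1%:E <= limn_einf (fun n : nat =>
         minimax_ratio d h C L
           (C `^ (2 * d%:R / (2 * h + d%:R)) *
            n%:R `^ (- (2 * h / (2 * h + d%:R)))) n))%E).
Proof.
have [K K0 Kbound] := @minimax_rate_bound R d h L h_gt0 h_le1 L_gt0.
have rate_gt0 n : (0 < n)%N -> 0 < n%:R `^ (- (2 * h / (2 * h + d%:R))) :> R.
  by move=> n0; rewrite powR_gt0// ltr0n.
split=> [C C0|].
  have [N NP] := Kbound C C0.
  (* For fixed [C] its power is absorbed into the constant. *)
  pose c := K * C `^ (2 * d%:R / (2 * h + d%:R)).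
  apply: (@lt_le_trans _ _ c%:E); first by rewrite lte_fin mulr_gt0// powR_gt0.
  (* [N.+1] excludes n = 0, where the rate is 0 and cannot serve as a positive denominator. *)
  apply: (@limn_einf_ge _ _ _ N.+1) => n Nn; apply: minimax_ratio_ge.
    by apply: rate_gt0; exact: leq_trans Nn.
  by rewrite /c -mulrA; apply: NP; exact: ltnW.
exists K => // C C0; have [N NP] := Kbound C C0.
apply: (@limn_einf_ge _ _ _ N.+1) => n Nn; apply: minimax_ratio_ge.
  by apply: mulr_gt0; [rewrite powR_gt0|apply: rate_gt0; exact: leq_trans Nn].
by apply: NP; exact: ltnW.
Qed.
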